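(* Let $q$ be an odd prime. Let $\widetilde{\mathcal N}(2q)$ be the number of (centrally) nilpotent loops of order $2q$ counted up to isotopism, and let $\mathcal N(2q)$ be the number of nilpotent loops of order $2q$ counted up to isomorphism. Then \begin{align*} \widetilde{\mathcal N}(2q) ={}& \frac{2^{(q-2)(q-1)}}{q^2(q-1)}+\frac{1}{q-1}\sum_{\emptyset\neq D\subseteq \mathrm{Pred}(q-1)}(-1)^{|D|}2^{(q-2)\gcd(D)}\\ &+\sum_{d\mid q-1,\ 1\le d<q-1}\frac1d\Bigg(2^{(q-2)d}+\sum_{\emptyset\neq D\subseteq \mathrm{Pred}(d)}(-1)^{|D|}2^{(q-2)\gcd(D)}\Bigg)\\ &+\frac{1}{q^2}\Big((q-2)2^{q-1}+3\Big)\\ ={}&\mathcal N(2q)+\frac{1}{q^2}\Big(-(q+1)2^{(q-2)(q-1)}+(q-2)2^{q-1}+3\Big). \end{align*}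
   Context: A loop is a set $Q$ with a binary operation having a two-sided neutral element and such that for all $a,b\in Q$ the equations $a\cdot x=b$ and $y\cdot a=b$ have unique solutions $x,y$. The center $Z(Q)$ is the set of $x\in Q$ with $xy=yx$, $(xy)z=x(yz)$, $(yx)z=y(xz)$, $(yz)x=y(zx)$ for all $y,z\in Q$; it is a normal subloop (normal subloops are kernels of loop homomorphisms). The upper central series is given by $Z_0(Q)=1$ and $Z_{i+1}(Q)$ the preimage in $Q$ of $Z(Q/Z_i(Q))$. $Q$ is (centrally) nilpotent if $Z_n(Q)=Q$ for some $n$. Two loops $(L_1,\cdot)$, $(L_2,\ast)$ are isotopic if there are bijections $\alpha,\beta,\gamma:L_1\to L_2$ with $\alpha(x)\ast\beta(y)=\gamma(x\cdot y)$ for all $x,y\in L_1$; such a triple is an isotopism. Counting ''up to isotopism'' (resp. ''up to isomorphism'') means counting isotopy (resp. isomorphism) classes. For a positive integer $d$, $\mathrm{Pred}(d)=\{d' : 1\le d'<d,\ d' \text{ divides } d,\ d/d' \text{ is a prime}\}$. For a nonempty finite set $D$ of positive integers, $\gcd(D)$ is the greatest common divisor of its elements. *)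

(* Defs.v *)
From mathcomp Require Import all_boot all_order all_algebra.
From mathcomp Require Import boolp classical_sets.

Set Implicit Arguments.
Unset Strict Implicit.
Unset Printing Implicit Defensive.

Local Open Scope classical_set_scope.

Definition neutral (T : Type) (op : T -> T -> T) (e : T) : Prop :=
  forall x, op e x = x /\ op x e = x.

Definition is_loop (T : Type) (op : T -> T -> T) : Prop :=
  [/\ exists e, neutral op e,
      forall a b, exists! x, op a x = b
    & forall a b, exists! y, op y a = b].

Definition loop_center (T : Type) (op : T -> T -> T) : set T :=
  [set x | forall y z,
    [/\ op x y = op y x,
        op (op x y) z = op x (op y z),
        op (op y x) z = op y (op x z)
      & op (op y z) x = op y (op z x)]].

Definition loop_coset (T : Type) (op : T -> T -> T) (N : set T) (x : T) :
  set T := [set op x n | n in N].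

(* The carrier of the quotient by N is the set of cosets xN. The product of
   two cosets is computed on chosen representatives; for N a normal subloop
   the choice is irrelevant and the quotient is a loop (loop_quo_mulE and
   loop_quo_loop below). *)
Definition loop_quo (T : Type) (op : T -> T -> T) (N : set T) : Type :=
  {A : set T | exists x, A = loop_coset op N x}.

Definition loop_proj (T : Type) (op : T -> T -> T) (N : set T) (x : T) :
  loop_quo op N := exist _ (loop_coset op N x) (ex_intro _ x erefl).

Definition loop_repr (T : Type) (op : T -> T -> T) (N : set T)
  (A : loop_quo op N) : T := sval (cid (svalP A)).

Definition loop_quo_mul (T : Type) (op : T -> T -> T) (N : set T)
    (A B : loop_quo op N) : loop_quo op N :=
  loop_proj op N (op (loop_repr A) (loop_repr B)).

(* Each term of the series is a normal subloop (upper_central_normal below),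
   so the quotients taken here are genuine quotient loops. *)
Fixpoint upper_central (T : Type) (op : T -> T -> T) (i : nat) : set T :=
  if i is j.+1 then
    let N := upper_central op j in
    [set x | loop_center (@loop_quo_mul T op N) (loop_proj op N x)]
  else [set e | neutral op e].

Definition loop_nilpotent (T : Type) (op : T -> T -> T) : Prop :=
  exists n, upper_central op n = setT.

Definition isotopic (T1 T2 : Type) (op1 : T1 -> T1 -> T1)
    (op2 : T2 -> T2 -> T2) : Prop :=
  exists a b c : T1 -> T2,
    [/\ bijective a, bijective b, bijective c
      & forall x y, op2 (a x) (b y) = c (op1 x y)].

Definition loop_isomorphic (T1 T2 : Type) (op1 : T1 -> T1 -> T1)
    (op2 : T2 -> T2 -> T2) : Prop :=
  exists2 f : T1 -> T2, bijective f
    & forall x y, f (op1 x y) = op2 (f x) (f y).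

(* Every loop of order n is isomorphic to one carried by 'I_n, so classes of
   loops of order n are counted among multiplication tables on 'I_n. *)
Definition mul_table (n : nat) := {ffun 'I_n * 'I_n -> 'I_n}.

Definition table_op (n : nat) (t : mul_table n) : 'I_n -> 'I_n -> 'I_n :=
  fun x y => t (x, y).

Definition nilpotent_loops (n : nat) : {set mul_table n} :=
  finset (fun t : mul_table n =>
    `[< is_loop (table_op t) /\ loop_nilpotent (table_op t) >]).

Definition num_nilpotent_isotopy (n : nat) : nat :=
  #|equivalence_partition
      (fun s t : mul_table n => `[< isotopic (table_op s) (table_op t) >])
      (nilpotent_loops n)|.

Definition num_nilpotent_iso (n : nat) : nat :=
  #|equivalence_partition
      (fun s t : mul_table n =>
         `[< loop_isomorphic (table_op s) (table_op t) >])
      (nilpotent_loops n)|.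

(* Elements of 'I_d carry the bound d' < d. *)
Definition Pred (d : nat) : {set 'I_d} :=
  finset (fun d' : 'I_d => [&& 0 < d', d' %| d & prime (d %/ d')]).

Definition gcd_set (d : nat) (D : {set 'I_d}) : nat :=
  \big[gcdn/0]_(i in D) (i : nat).

Lemma isotopic_refl (T : Type) (op : T -> T -> T) : isotopic op op.
Proof. by exists id, id, id; split=> //; exists id. Qed.

Lemma isotopic_sym (T1 T2 : Type) (op1 : T1 -> T1 -> T1)
    (op2 : T2 -> T2 -> T2) : isotopic op1 op2 -> isotopic op2 op1.
Proof.
move=> [a [b [c [[a' aK aK'] [b' bK bK'] [c' cK cK'] h]]]].
exists a', b', c'; split; [by exists a | by exists b | by exists c |].
by move=> x y; rewrite -[op1 _ _]cK -h aK' bK'.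
Qed.

Lemma isotopic_trans (T1 T2 T3 : Type) (op1 : T1 -> T1 -> T1)
    (op2 : T2 -> T2 -> T2) (op3 : T3 -> T3 -> T3) :
  isotopic op1 op2 -> isotopic op2 op3 -> isotopic op1 op3.
Proof.
move=> [a [b [c [ba bb bc h]]]] [a' [b' [c' [ba' bb' bc' h']]]].
exists (a' \o a), (b' \o b), (c' \o c).
by split=> [||| x y /=]; [exact: bij_comp .. | rewrite h' h].
Qed.

Lemma loop_isomorphic_refl (T : Type) (op : T -> T -> T) :
  loop_isomorphic op op.
Proof. by exists id => //; exists id. Qed.

Lemma loop_isomorphic_sym (T1 T2 : Type) (op1 : T1 -> T1 -> T1)
    (op2 : T2 -> T2 -> T2) : loop_isomorphic op1 op2 -> loop_isomorphic op2 op1.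
Proof.
move=> [f [g fK gK] h]; exists g; first by exists f.
by move=> x y; rewrite -[op1 _ _]fK h !gK.
Qed.

Lemma loop_isomorphic_trans (T1 T2 T3 : Type) (op1 : T1 -> T1 -> T1)
    (op2 : T2 -> T2 -> T2) (op3 : T3 -> T3 -> T3) :
  loop_isomorphic op1 op2 -> loop_isomorphic op2 op3 ->
  loop_isomorphic op1 op3.
Proof.
move=> [f bf h] [g bg h']; exists (g \o f); first exact: bij_comp.
by move=> x y /=; rewrite h h'.
Qed.

Definition normal_subloop (T : Type) (op : T -> T -> T) (N : set T) : Prop :=
  exists (T' : Type) (op' : T' -> T' -> T') (f : T -> T'),
    [/\ is_loop op', forall x y, f (op x y) = op' (f x) (f y)
      & N = [set x | neutral op' (f x)]].

Lemma loop_cancell (T : Type) (op : T -> T -> T) (L : is_loop op) a x y :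
  op a x = op a y -> x = y.
Proof.
by case: L => _ h _ e; case: (h a (op a y)) => z [_ zu];
  rewrite -(zu x) // -(zu y).
Qed.

Lemma loop_cancelr (T : Type) (op : T -> T -> T) (L : is_loop op) a x y :
  op x a = op y a -> x = y.
Proof.
by case: L => _ _ h e; case: (h a (op y a)) => z [_ zu];
  rewrite -(zu x) // -(zu y).
Qed.

Lemma loop_divl (T : Type) (op : T -> T -> T) (L : is_loop op) a b :
  exists x, op a x = b.
Proof. by case: L => _ h _; case: (h a b) => z [zP _]; exists z. Qed.

Lemma loop_divr (T : Type) (op : T -> T -> T) (L : is_loop op) a b :
  exists y, op y a = b.
Proof. by case: L => _ _ h; case: (h a b) => z [zP _]; exists z. Qed.

Lemma neutral_unitl (T : Type) (op : T -> T -> T) (a u : T) :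
  is_loop op -> op a u = a -> neutral op u.
Proof.
move=> L au; have [[e en] _ _] := L.
by rewrite (_ : u = e) //; apply: (loop_cancell L (a := a)); rewrite au (en a).2.
Qed.

Lemma loop_projP (T : Type) (op : T -> T -> T) (N : set T) x y :
  loop_proj op N x = loop_proj op N y <->
  loop_coset op N x = loop_coset op N y.
Proof. by split=> [/(congr1 sval)//|e]; apply: eq_sig_hprop. Qed.

Lemma loop_reprK (T : Type) (op : T -> T -> T) (N : set T)
  (A : loop_quo op N) : loop_proj op N (loop_repr A) = A.
Proof.
by apply: eq_sig_hprop => //=; rewrite /loop_repr; case: cid.
Qed.

Definition coset_congruence (T : Type) (op : T -> T -> T) (N : set T) : Prop :=
  let R x y := loop_coset op N x = loop_coset op N y in
  [/\ forall x x' y y', R x x' -> R y y' -> R (op x y) (op x' y'),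
      forall a x y, R (op a x) (op a y) -> R x y
    & forall a x y, R (op x a) (op y a) -> R x y].

Lemma congruence_quo_mulE (T : Type) (op : T -> T -> T) (N : set T) :
  coset_congruence op N ->
  forall x y, loop_quo_mul (loop_proj op N x) (loop_proj op N y)
            = loop_proj op N (op x y).
Proof.
by move=> [c _ _] x y; apply/loop_projP/c; apply/loop_projP;
  rewrite loop_reprK.
Qed.

Lemma congruence_quo_loop (T : Type) (op : T -> T -> T) (N : set T) :
  is_loop op -> coset_congruence op N -> is_loop (@loop_quo_mul T op N).
Proof.
move=> L cN; have mE := congruence_quo_mulE cN.
case: cN => [_ cl cr]; split.
- have [[e en] _ _] := L; exists (loop_proj op N e) => A.
  by rewrite -[A]loop_reprK !mE (en _).1 (en _).2.
- move=> A B; rewrite -[A]loop_reprK -[B]loop_reprK.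
  move: (loop_repr A) (loop_repr B) => a b.
  have [x xE] := loop_divl L a b.
  exists (loop_proj op N x); split; first by rewrite mE xE.
  move=> C; rewrite -[C]loop_reprK mE => /loop_projP h.
  by apply/loop_projP/(cl a); rewrite h xE.
- move=> A B; rewrite -[A]loop_reprK -[B]loop_reprK.
  move: (loop_repr A) (loop_repr B) => a b.
  have [x xE] := loop_divr L a b.
  exists (loop_proj op N x); split; first by rewrite mE xE.
  move=> C; rewrite -[C]loop_reprK mE => /loop_projP h.
  by apply/loop_projP/(cr a); rewrite h xE.
Qed.

Lemma normal_coset_eq (T : Type) (op : T -> T -> T) (N : set T)
    (T' : Type) (op' : T' -> T' -> T') (f : T -> T') :
  is_loop op -> is_loop op' -> (forall x y, f (op x y) = op' (f x) (f y)) ->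
  N = [set x | neutral op' (f x)] ->
  forall x y, loop_coset op N x = loop_coset op N y <-> f x = f y.
Proof.
move=> L L' fM NE x y.
have sub u v : f u = f v -> loop_coset op N u `<=` loop_coset op N v.
  move=> uv z [n Nn <-]; have [m mE] := loop_divl L v (op u n).
  exists m => //; rewrite NE /=; apply: (neutral_unitl (a := f v) L').
  rewrite -fM mE fM uv; move: Nn; rewrite NE => /= nn; exact: (nn _).2.
split=> [xy|xy]; last by apply/seteqP; split; apply: sub.
have [[e en] _ _] := L.
have Ne : N e.
  by rewrite NE /=; apply: (neutral_unitl (a := f e) L'); rewrite -fM (en e).1.
have : loop_coset op N y x by rewrite -xy; exists e => //; rewrite (en x).2.
by case=> n; rewrite NE /= => nn <-; rewrite fM (nn _).2.
Qed.

Lemma normal_congruence (T : Type) (op : T -> T -> T) (N : set T) :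
  is_loop op -> normal_subloop op N -> coset_congruence op N.
Proof.
move=> L [T' [op' [f [L' fM NE]]]].
have cE := normal_coset_eq L L' fM NE; split.
- by move=> x x' y y' /cE ex /cE ey; apply/cE; rewrite !fM ex ey.
- move=> a x y /cE; rewrite !fM => h; apply/cE; exact: (loop_cancell L' h).
- move=> a x y /cE; rewrite !fM => h; apply/cE; exact: (loop_cancelr L' h).
Qed.

Lemma loop_quo_mulE (T : Type) (op : T -> T -> T) (N : set T) :
  is_loop op -> normal_subloop op N ->
  forall x y, loop_quo_mul (loop_proj op N x) (loop_proj op N y)
            = loop_proj op N (op x y).
Proof. by move=> L nN; apply/congruence_quo_mulE/normal_congruence. Qed.

Lemma loop_quo_loop (T : Type) (op : T -> T -> T) (N : set T) :
  is_loop op -> normal_subloop op N -> is_loop (@loop_quo_mul T op N).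
Proof. by move=> L nN; apply/congruence_quo_loop/normal_congruence. Qed.

Lemma loop_center_normal (T : Type) (op : T -> T -> T) :
  is_loop op -> normal_subloop op (loop_center op).
Proof.
move=> L; have [[e en] _ _] := L; set C := loop_center op.
have mC c : C c -> forall y z, [/\ op c y = op y c,
    op (op c y) z = op c (op y z), op (op y c) z = op y (op c z)
  & op (op y z) c = op y (op z c)] by [].
have CI c : (forall y z, [/\ op c y = op y c, op (op c y) z = op c (op y z)
    & op (op y c) z = op y (op c z)]) -> C c.
  move=> h y z; have [h1 h2 h3] := h y z; split=> //.
  by have [<- _ _] := h (op y z) y; have [<- _ _] := h z y; rewrite -h3 -h1 h2.
have Ce : C e.
  by apply: CI => y z; rewrite !(en _).1 !(en _).2.
have cC c y : C c -> op c y = op y c by move=> /mC/(_ y y)[].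
have c1 c y z : C c -> op (op c y) z = op c (op y z) by move=> /mC/(_ y z)[].
have c2 c y z : C c -> op (op y c) z = op y (op c z) by move=> /mC/(_ y z)[].
have c3 c y z : C c -> op (op y z) c = op y (op z c) by move=> /mC/(_ y z)[].
have CM c d : C c -> C d -> C (op c d).
  move=> Cc Cd.
  have k1 y : op (op c d) y = op y (op c d).
    by rewrite (c1 c d y) // (cC d y) // -(c1 c y d) // (cC c y) // c2.
  have k2 y z : op (op (op c d) y) z = op (op c d) (op y z).
    by rewrite (c1 c d y) // (c1 c _ z) // (c1 d y z) // (c1 c d).
  apply: CI => y z; split=> //; rewrite -k1 k2 (c1 c d _) // (c1 c d z) //.
  rewrite -(c2 c y _) // -(cC c y) // (c1 c y) // -(c2 d y z) // -(cC d y) //.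
  by rewrite (c1 d y z).
have CV c : C c -> exists2 d, C d & op c d = e.
  move=> Cc; have [d cd] := loop_divl L c e; exists d => //.
  have j y : op c (op d y) = y by rewrite -c1 // cd (en _).1.
  have j' y : op c (op y d) = y by rewrite -c1 // (cC c) // c2 // cd (en _).2.
  apply: CI => y z; split; apply: (loop_cancell L (a := c)).
  - by rewrite j j'.
  - by rewrite -c1 // !j.
  - by rewrite -c1 // j' -c1 // (cC c) // c2 // j.
have cE x y : loop_coset op C x = loop_coset op C y <->
    exists2 c, C c & y = op x c.
  have sub u c : C c -> loop_coset op C (op u c) `<=` loop_coset op C u.
    by move=> Cc _ [n Cn <-]; exists (op c n); [exact: CM | rewrite c2].
  split=> [xy|[c Cc ->]].
    have : loop_coset op C x y by rewrite xy; exists e => //; rewrite (en y).2.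
    by case=> c Cc <-; exists c.
  apply/seteqP; split; last exact: sub.
  have [d Cd cd] := CV c Cc.
  by rewrite [in X in X `<=` _](_ : x = op (op x c) d);
    [exact: sub | rewrite c2 // cd (en _).2].
have cong : coset_congruence op C.
  split.
  - move=> x x' y y' /cE[c Cc ->] /cE[d Cd ->]; apply/cE.
    exists (op c d); first exact: CM.
    by rewrite -(c3 d (op x c) y) // (c2 c x y) // (cC c y) //
      -(c3 c x y) // (c3 d).
  - move=> a x y /cE[c Cc h]; apply/cE; exists c => //.
    by apply: (loop_cancell L (a := a)); rewrite h c3.
  - move=> a x y /cE[c Cc h]; apply/cE; exists c => //.
    by apply: (loop_cancelr L (a := a)); rewrite h c3 // -(cC c a) // c2.
have QL := congruence_quo_loop L cong.
have mE := congruence_quo_mulE cong.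
exists (loop_quo op C), (@loop_quo_mul T op C), (loop_proj op C).
split=> //; apply/seteqP; split=> x /=.
- move=> Cx; apply: (neutral_unitl (a := loop_proj op C e) QL).
  rewrite mE; apply/esym/loop_projP/cE; exists x => //.
- move=> nx; have := (nx (loop_proj op C e)).2; rewrite mE (en x).1.
  move=> /esym/loop_projP/cE[c Cc]; by rewrite (en c).1 => ->.
Qed.

Lemma upper_central_normal (T : Type) (op : T -> T -> T) (i : nat) :
  is_loop op -> normal_subloop op (upper_central op i).
Proof.
move=> L; elim: i => [|i IH]; first by exists T, op, id.
have QL := loop_quo_loop L IH.
have mE := loop_quo_mulE L IH.
have [T' [op' [f [L' fM NE]]]] := loop_center_normal QL.
exists T', op', (f \o loop_proj op (upper_central op i)); split=> //.
- by move=> x y /=; rewrite -mE fM.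
- by rewrite /= NE.
Qed.

(* Main.v *)
Require Import Defs.
From HB Require Import structures.
From mathcomp Require Import boolp classical_sets.
From mathcomp Require Import all_boot all_fingroup all_algebra all_solvable.
From mathcomp Require Import zify ring.
Set Implicit Arguments.
Unset Strict Implicit.
Unset Printing Implicit Defensive.
Import GRing.Theory Num.Theory.
Local Open Scope group_scope.
Local Open Scope ring_scope.

(** A nilpotent loop of order 2q has a central involution with quotient Z/q, so
    it lives on Z/2 x F_q with (a, x)(b, y) = (a + b + f(x, y), x + y). An
    isotopism between two such loops commutes with translation by the central
    involution, hence acts on F_q by affine maps: f and g give isotopic loops
    iff g(ux + s, uy + t) - f(x, y) = a(x) + b(y) + c(x + y) for some unit u,
    some s, t and some functions a, b, c, and isomorphic loops iff this is
    possible with s = t = 0. Modulo the functions a(x) + b(y) + c(x + y) every f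
    has a unique representative vanishing for x = 0, for y = 0 and for x = y.
    Isotopy classes are thus the orbits of the maps (x, y) |-> (ux + s, uy + t)
    on these normal forms, and isomorphism classes those of the cyclic subgroup
    s = t = 0, which permutes the pairs of distinct nonzero elements freely.

    The orbits of a cyclic group are counted according to their size d: the
    points concerned are those fixed by the d-th power of the generator but not
    by its powers of exponent d / p, p prime. For the large group the
    Cauchy-Frobenius formula applies: a map with u <> 1 is conjugate to its
    linear part, so it fixes as many classes as in the count of isomorphism
    classes, and the classes fixed by the translation by (s, t) <> 0 are those
    of the functions invariant under it, namely one class if s, t or s + t is 0
    and 2^(q-1) classes otherwise. *)

(** * Inclusion-exclusion and orbit counting *)

Lemma sum_signed_subsets (R : pzRingType) (I : finType) (P : {set I}) :
  \sum_(D : {set I} | D \subset P) (-1) ^+ #|D| = (P == set0)%:R :> R.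
Proof.
have [->|[a aP]] := set_0Vmem P.
  by rewrite (big_pred1 set0) ?cards0 ?eqxx // => D; rewrite subset0.
rewrite (negbTE (_ : P != set0)); last by apply/set0Pn; exists a.
rewrite (bigID (fun D : {set I} => a \in D)) /=.
rewrite (reindex_onto (fun D => a |: D) (fun D => D :\ a)) /=; last first.
  by move=> D /andP[_ aD]; rewrite setD1K.
apply/eqP; rewrite addr_eq0 -sumrN; apply/eqP/eq_big => D.
  rewrite setU11 andbT subUset sub1set aP /=; congr (_ && _).
  apply/eqP/idP => [<-|aD]; first by rewrite !inE eqxx.
  by rewrite setU1K.
move=> /andP[_ /eqP DE]; have aD : a \notin D by rewrite -DE !inE eqxx.
by rewrite cardsU1 aD add1n exprS mulN1r.
Qed.

Lemma natr_card_setI (R : pzSemiRingType) (T : finType) (A B : {set T}) :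
  #|A :&: B|%:R = \sum_(x in A) (x \in B)%:R :> R.
Proof.
rewrite -sum1_card natr_sum (eq_bigl (fun x => (x \in A) && (x \in B))).
  by rewrite big_mkcondr; apply: eq_bigr => x _; case: (x \in B).
by move=> x; rewrite inE.
Qed.

Lemma inclusion_exclusion (R : comPzRingType) (I T : finType) (P : {set I})
    (S : {set T}) (A : I -> {set T}) :
  #|S :\: \bigcup_(i in P) A i|%:R =
  \sum_(D : {set I} | D \subset P)
     (-1) ^+ #|D| * #|S :&: \bigcap_(i in D) A i|%:R :> R.
Proof.
rewrite setDE natr_card_setI.
under [RHS]eq_bigr do rewrite natr_card_setI mulr_sumr.
rewrite exchange_big /=; apply: eq_bigr => x Sx.
pose Px := [set i in P | x \in A i].
have subPx (D : {set I}) :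
    (D \subset Px) = (D \subset P) && (x \in \bigcap_(i in D) A i).
  apply/subsetP/andP => [DPx|[/subsetP DP /bigcapP xD] i iD].
    split; first by apply/subsetP => i /DPx; rewrite inE => /andP[].
    by apply/bigcapP => i /DPx; rewrite inE => /andP[].
  by rewrite inE DP ?xD.
transitivity ((Px == set0)%:R : R).
  congr (nat_of_bool _)%:R; rewrite inE -[RHS]negbK; congr (~~ _).
  apply/bigcupP/set0Pn => [[i iP xi]|[i]]; first by exists i; rewrite inE iP.
  by rewrite inE => /andP[iP xi]; exists i.
rewrite -sum_signed_subsets (eq_bigl _ _ subPx) big_mkcondr /=.
by apply: eq_bigr => D _; case: (x \in _); rewrite ?mulr1 ?mulr0.
Qed.

(* The Moebius inverse of F at d, where mu(d / e) arises by summing signs over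
   the sets of maximal proper divisors of d with gcd e. The empty set stands for
   e = d and is kept apart because gcd_set set0 = 0. *)
Definition Pred_moebius (R : pzRingType) (F : nat -> R) (d : nat) : R :=
  F d + \sum_(D : {set 'I_d} | (D != set0) && (D \subset Pred d))
          (-1) ^+ #|D| * F (gcd_set D).

Lemma dvdn_gcd_set d (D : {set 'I_d}) m :
  (m %| gcd_set D)%N = [forall i in D, m %| i]%N.
Proof. by apply/dvdn_biggcdP/forall_inP. Qed.

Lemma gcd_set_dvd d (D : {set 'I_d}) :
  D != set0 -> D \subset Pred d -> (gcd_set D %| d)%N.
Proof.
move=> /set0Pn[i iD] /subsetP/(_ i iD); rewrite inE => /and3P[_ i_dvd _].
exact: biggcdn_inf iD i_dvd.
Qed.

Lemma eqn_dvd_Pred m d : (0 < d)%N ->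
  (m == d) = (m %| d)%N && [forall i in Pred d, ~~ (m %| i)]%N.
Proof.
move=> d_gt0; apply/eqP/andP => [->|[/dvdnP[k dE] /forall_inP mPred]].
  split=> //; apply/forall_inP => i; rewrite inE => /and3P[i_gt0 _ _].
  by apply: contraL (ltn_ord i) => /(dvdn_leq i_gt0); rewrite -leqNgt.
have [k_gt1|k_le1] := ltnP 1 k; last first.
  by case: k dE k_le1 => [|[|//]] dE _; move: d_gt0; rewrite dE // mul1n.
have p_pr := pdiv_prime k_gt1; have p_dvd_k := pdiv_dvd k.
have p_dvd_d : (pdiv k %| d)%N by rewrite dE dvdn_mulr.
have lt_d : (d %/ pdiv k < d)%N by apply: ltn_Pdiv (prime_gt1 p_pr) d_gt0.
have /mPred/negP[] : Ordinal lt_d \in Pred d.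
  by rewrite inE /= divn_gt0 ?pdiv_gt0 // dvdn_leq // dvdn_div // divnA ?mulKn.
by rewrite /= dE -divn_mulAC // dvdn_mull.
Qed.

Section OrbitCounting.

Variables (aT : finGroupType) (T : finType) (to : {action aT &-> T}).

Lemma card_Fix_conj (a b : aT) : #|'Fix_to[(a ^ b)%g]| = #|'Fix_to[a]|.
Proof.
rewrite -[RHS](card_imset _ (act_inj to b)); apply: eq_card => x.
rewrite -[x](actKV to b) (mem_imset _ _ (act_inj to b)).
by apply/afix1P/afix1P; rewrite -actCJ; [apply: act_inj | move->].
Qed.

Variable S : {set T}.

Lemma card_semiregular (G : {group aT}) :
  [acts G, on S | to] -> {in S, forall x, 'C_G[x | to] = 1%g} ->
  #|S| = (#|orbit to G @: S| * #|G|)%N.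
Proof.
move=> GactsS free; apply: card_uniform_partition (orbit_partition GactsS).
move=> _ /imsetP[x Sx ->].
by have := card_orbit_stab to G x; rewrite free // cards1 muln1.
Qed.

Lemma natr_card_orbits (R : numFieldType) (G : {group aT}) :
  [acts G, on S | to] ->
  #|orbit to G @: S|%:R = \sum_(x in S) #|orbit to G x|%:R^-1 :> R.
Proof.
move=> GactsS; rewrite (set_partition_big _ (orbit_partition GactsS)) /=.
rewrite -sum1_card natr_sum; apply: eq_bigr => _ /imsetP[x _ ->].
rewrite (eq_bigr (fun=> #|orbit to G x|%:R^-1)) => [|y /orbit_eqP-> //].
rewrite sumr_const -[RHS]mulr_natl divff // pnatr_eq0 -lt0n.
by apply/card_gt0P; exists x; apply: orbit_refl.
Qed.

Variable a : aT.

Lemma dvdn_card_orbit_cycle x e :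
  (#|orbit to <[a]> x| %| e)%N = (x \in 'Fix_to[(a ^+ e)%g]).
Proof.
have -> : (x \in 'Fix_to[(a ^+ e)%g]) = ((a ^+ e)%g \in 'C_(<[a]>)[x | to]).
  by rewrite in_setI mem_cycle; apply/afix1P/astab1P.
rewrite -cycle_subG -(cardSg_cyclic (cycle_cyclic a)) ?subsetIl ?cycleX //.
have := card_orbit_stab to <[a]> x; rewrite -!orderE orderXgcd.
move: #|orbit _ _ x| #|'C_(_)[_ | _]| => orb stab orb_stab.
have a_gt0 := order_gt0 a; have stab_gt0 : (0 < stab)%N by nia.
have -> : (orb %| e)%N = (orb %| gcdn #[a] e)%N.
  by rewrite dvdn_gcd -orb_stab dvdn_mulr.
rewrite -(dvdn_pmul2r stab_gt0) orb_stab -{1}(divnK (dvdn_gcdl #[a] e)) mulnC.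
by rewrite dvdn_pmul2l // gcdn_gt0 a_gt0.
Qed.

Lemma natr_card_orbit_cycle_eq (R : comPzRingType) d : (0 < d)%N ->
  #|[set x in S | #|orbit to <[a]> x| == d]|%:R =
  Pred_moebius (fun e => #|'Fix_(S | to)[(a ^+ e)%g]|%:R : R) d.
Proof.
move=> d_gt0; pose fixed (e : nat) := 'Fix_to[(a ^+ e)%g].
have -> : [set x in S | #|orbit to <[a]> x| == d] =
    (S :&: fixed d) :\: \bigcup_(i in Pred d) fixed i.
  apply/setP => x; rewrite inE eqn_dvd_Pred // dvdn_card_orbit_cycle.
  rewrite in_setD in_setI andbA andbC; congr (_ && _).
  apply/forall_inP/negP => [not_dvd /bigcupP[i /not_dvd]|not_fixed i iPred].
    by rewrite dvdn_card_orbit_cycle => /negP.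
  apply/negP => dvd_i; apply/not_fixed/bigcupP.
  by exists i; rewrite -?dvdn_card_orbit_cycle.
rewrite inclusion_exclusion (bigD1 set0) ?sub0set //= big_set0 setIT.
rewrite cards0 mul1r; congr (_ + _).
apply: eq_big => [D|D /andP[DPred D0]]; first by rewrite andbC.
congr (_ * #|pred_of_set _|%:R); rewrite -setIA; congr (_ :&: _).
apply/setP => x; rewrite inE -!dvdn_card_orbit_cycle dvdn_gcd_set.
apply/andP/forall_inP => [[_ /bigcapP xD] i /xD|dvdD].
  by rewrite -dvdn_card_orbit_cycle.
split; last by apply/bigcapP => i /dvdD; rewrite dvdn_card_orbit_cycle.
apply: dvdn_trans (gcd_set_dvd D0 DPred).
by rewrite dvdn_gcd_set; apply/forall_inP.
Qed.

Lemma natr_card_orbits_cycle (R : numFieldType) : [acts <[a]>, on S | to] ->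
  #|orbit to <[a]> @: S|%:R =
  \sum_(1 <= d < #[a].+1 | (d %| #[a])%N)
    d%:R^-1 * Pred_moebius (fun e => #|'Fix_(S | to)[(a ^+ e)%g]|%:R : R) d.
Proof.
move=> /natr_card_orbits->.
transitivity (\sum_(x in S) \sum_(1 <= d < #[a].+1 | (d %| #[a])%N)
                 (if #|orbit to <[a]> x| == d then d%:R^-1 else 0) : R).
  apply: eq_bigr => x _; have orb_dvd := dvdn_orbit to <[a]> x.
  have orb_gt0 : (0 < #|orbit to <[a]> x|)%N by rewrite (dvdn_gt0 _ orb_dvd).
  rewrite -big_mkcondr (eq_bigl (fun d => d == #|orbit to <[a]> x|)) => [|d].
    by rewrite big_nat1_eq orb_gt0 ltnS orderE dvdn_leq.
  by rewrite andbC eq_sym; case: eqP => // ->; rewrite orderE.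
rewrite exchange_big /= big_nat_cond [RHS]big_nat_cond; apply: eq_bigr => d.
move=> /andP[/andP[d_gt0 _] _]; rewrite -natr_card_orbit_cycle_eq //.
rewrite mulrC mulr_natl -big_mkcondr -sumr_const; apply: eq_bigl => x.
by rewrite inE.
Qed.

End OrbitCounting.

Lemma card_equivalence_partition_orbits (aT : finGroupType) (T1 T2 : finType)
    (to : {action aT &-> T1}) (G : {group aT}) (R : rel T2) (D : {set T2})
    (h : T1 -> T2) :
  {in D & &, equivalence_rel R} -> (forall x, h x \in D) ->
  {in D, forall y, exists x, R (h x) y} ->
  (forall x y, R (h x) (h y) = (y \in orbit to G x)) ->
  #|equivalence_partition R D| = #|orbit to G @: setT|.
Proof.
move=> eqR hD hR Rorbit.
have classE x y : x \in D -> y \in D -> R x y ->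
    [set z in D | R x z] = [set z in D | R y z].
  move=> Dx Dy xy; apply/setP => z; rewrite !inE.
  by case Dz: (z \in D) => //=; have [_ ->] := eqR x y z Dx Dy Dz.
have -> : equivalence_partition R D =
    (fun x => [set y in D | R (h x) y]) @: setT.
  apply/setP => B; apply/imsetP/imsetP => [[y Dy ->]|[x _ ->]]; last first.
    by exists (h x).
  have [x xy] := hR y Dy; exists x; rewrite ?inE //.
  exact/esym/classE.
have orbitE x : h @^-1: [set y in D | R (h x) y] = orbit to G x.
  by apply/setP => y; rewrite !inE hD Rorbit.
have preI : {in (fun x => [set y in D | R (h x) y]) @: setT &,
    injective (fun B : {set T2} => h @^-1: B)}.
  move=> _ _ /imsetP[x _ ->] /imsetP[y _ ->]; rewrite !orbitE => /orbit_eqP.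
  by rewrite -Rorbit => /(classE _ _ (hD _) (hD _))->.
rewrite -(card_in_imset preI) -imset_comp; congr #|pred_of_set _|.
by apply: eq_imset => x; apply: orbitE.
Qed.

Section FunctionAction.

Variables (aT : finGroupType) (T R : finType) (to : {action aT &-> T}).

Definition ffun_act (f : {ffun T -> R}) (a : aT) : {ffun T -> R} :=
  [ffun x => f (to x a^-1%g)].

Lemma ffun_act_is_action : is_action setT ffun_act.
Proof.
split=> [a f g /ffunP fg | f a b _ _]; apply/ffunP => x.
  by have := fg (to x a); rewrite !ffunE actK.
by rewrite !ffunE invMg actM.
Qed.

Canonical ffun_action : {action aT &-> {ffun T -> R}} :=
  Action ffun_act_is_action.

Lemma Fix_ffunP (f : {ffun T -> R}) (A : {set aT}) :
  reflect (forall x a, a \in A -> f (to x a) = f x) (f \in 'Fix_ffun_action(A)).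
Proof.
apply: (iffP afixP) => [fA x a /fA/ffunP/(_ (to x a))|fA a Aa].
  by rewrite ffunE actK.
by apply/ffunP => x; rewrite ffunE -[X in _ = f X](actKV to a) (fA _ a).
Qed.

Lemma Fix_ffun_vanishingP (f : {ffun T -> R}) (G : {group aT}) (x : T) (y : R) :
  reflect (f \in 'Fix_ffun_action(G) /\ f x = y)
    (f \in [set g in pffun_on y (~: orbit to G x) predT]
            :&: 'Fix_ffun_action(G)).
Proof.
apply: (iffP setIP) => [[]|[fG fx]].
  rewrite inE => /pffun_onP[/supportP f_out _] fG; split=> //.
  by apply: f_out; rewrite !inE orbit_refl.
split=> //; rewrite inE; apply/pffun_onP; split=> //; apply/supportP => z.
rewrite !inE negbK => /orbitP[a aG <-]; rewrite -fx.
by move/Fix_ffunP: fG => ->.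
Qed.

Lemma card_Fix_ffun (G : {group aT}) (Y : {set T}) (y : R) :
  [acts G, on Y | to] ->
  #|[set f in pffun_on y Y predT] :&: 'Fix_ffun_action(G)| =
    (#|R| ^ #|orbit to G @: Y|)%N.
Proof.
move=> GactsY.
pose pull (k : {ffun {set T} -> R}) := [ffun x => k (orbit to G x)].
have orbitY x : (orbit to G x \in orbit to G @: Y) = (x \in Y).
  apply/imsetP/idP => [[z Yz /orbit_eqP/orbitP[a Ga <-]]|Yx]; last by exists x.
  by rewrite (acts_act GactsY).
rewrite -(card_pffun_on y (mem (orbit to G @: Y)) predT).
rewrite -(@card_in_imset _ _ pull); last first.
  move=> k k' /pffun_onP[kY _] /pffun_onP[k'Y _] /ffunP kk'; apply/ffunP => B.
  have [/imsetP[x _ ->]|nB] := boolP (B \in orbit to G @: Y).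
    by have := kk' x; rewrite !ffunE.
  by rewrite (elimT supportP kY _ nB) (elimT supportP k'Y _ nB).
apply: eq_card => f; rewrite in_setI inE; apply/andP/imsetP => [[]|[k]].
  move=> /pffun_onP[/subsetP fY _] /Fix_ffunP fG.
  pose lift (B : {set T}) :=
    if [pick x in Y | orbit to G x == B] is Some x then f x else y.
  exists (finfun lift).
    apply/pffun_onP; split=> //; apply/subsetP => B; rewrite !inE ffunE /lift.
    by case: pickP => [x /andP[Yx /eqP<-]|]; rewrite ?eqxx // imset_f.
  apply/ffunP => x; rewrite !ffunE /lift.
  case: pickP => [z /andP[_ /eqP/orbit_eqP/orbitP[a Ga <-]]|noY].
    by rewrite fG.
  apply/eqP/negPn/negP => /fY Yx.
  by have := noY x; rewrite eqxx Yx.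
move=> /pffun_onP[/subsetP kY _] ->; split.
  apply/pffun_onP; split=> //; apply/subsetP => x; rewrite !inE ffunE.
  by rewrite -orbitY; apply: kY.
apply/Fix_ffunP => x a Ga; rewrite !ffunE; congr (k _).
by apply/orbit_eqP; rewrite mem_orbit.
Qed.

End FunctionAction.

(** * Upper central series of loops *)

Section LoopTheory.

Variables (T : Type) (op : T -> T -> T).
Hypothesis L : is_loop op.

Definition congruent (N : set T) (x y : T) : Prop :=
  exists2 n, N n & y = op x n.

Lemma eq_loop_projP (N : set T) : normal_subloop op N ->
  forall x y, loop_proj op N x = loop_proj op N y <-> congruent N x y.
Proof.
move=> [T' [op' [f [L' fM NE]]]] x y.
rewrite loop_projP (normal_coset_eq L L' fM NE); split=> [fxy|[n]].
  have [n nE] := loop_divl L x y; exists n => //; rewrite NE /=.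
  by apply: (neutral_unitl (a := f x) L'); rewrite -fM nE fxy.
by rewrite NE /= => fn ->; rewrite fM (fn _).2.
Qed.

Lemma normal_subloopMr (N : set T) : normal_subloop op N ->
  forall x n, N n -> N (op x n) <-> N x.
Proof. by move=> [T' [op' [f [_ fM ->]]]] x n /= fn; rewrite fM (fn _).2. Qed.

Lemma upper_centralSP i x : upper_central op i.+1 x <->
  forall y z, let N := upper_central op i in
    [/\ congruent N (op x y) (op y x),
        congruent N (op (op x y) z) (op x (op y z)),
        congruent N (op (op y x) z) (op y (op x z))
      & congruent N (op (op y z) x) (op y (op z x))].
Proof.
have nN := upper_central_normal i L.
have mE := loop_quo_mulE L nN; have pE := eq_loop_projP nN.
split=> /= [cx y z|cx A B].
  have := cx (loop_proj op _ y) (loop_proj op _ z).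
  by rewrite !mE; case=> /pE ? /pE ? /pE ? /pE ?.
rewrite -[A]loop_reprK -[B]loop_reprK !mE.
by have [? ? ? ?] := cx (loop_repr A) (loop_repr B); split; apply/pE.
Qed.

Lemma upper_central1 : upper_central op 1 = loop_center op.
Proof.
have congr0 a b : congruent (upper_central op 0) a b <-> a = b.
  split=> [[n nn ->]|->]; first by rewrite (nn a).2.
  by have [[e en] _ _] := L; exists e => //; rewrite (en b).2.
apply/seteqP; split=> x.
  move=> /upper_centralSP cx y z.
  by have [/congr0 ? /congr0 ? /congr0 ? /congr0 ?] := cx y z.
move=> cx; apply/upper_centralSP => y z /=.
by have [? ? ? ?] := cx y z; split; apply/congr0.
Qed.

Lemma upper_centralS i x : upper_central op i x -> upper_central op i.+1 x.
Proof.
have nN := upper_central_normal i L; have [[e en] _ _] := L.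
move=> Nx; have xe : loop_proj op (upper_central op i) x = loop_proj op _ e.
  by apply/esym/(eq_loop_projP nN); exists x => //; rewrite (en x).1.
have eA A : loop_quo_mul (loop_proj op (upper_central op i) e) A = A.
  by rewrite -[A]loop_reprK !(loop_quo_mulE L nN) (en _).1.
have Ae A : loop_quo_mul A (loop_proj op (upper_central op i) e) = A.
  by rewrite -[A]loop_reprK !(loop_quo_mulE L nN) (en _).2.
by rewrite /= xe => A B; split; rewrite ?eA ?Ae.
Qed.

Lemma upper_central_stationary i : loop_nilpotent op ->
  (forall x, upper_central op i.+1 x -> upper_central op i x) ->
  forall x, upper_central op i x.
Proof.
move=> [n nE] stop.
have iE : upper_central op i.+1 = upper_central op i.
  by apply/seteqP; split=> // x; apply: upper_centralS.
have stat k : upper_central op (k + i) = upper_central op i.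
  by elim: k => // k IHk; rewrite addSn -[RHS]iE /= IHk.
have mono k x : upper_central op n x -> upper_central op (k + n) x.
  by elim: k => // k IHk /IHk; apply: upper_centralS.
by move=> x; rewrite -(stat n) addnC; apply: mono; rewrite nE.
Qed.

Section Center.

Variables (z : T) (zC : loop_center op z).

Lemma centerC y : op z y = op y z. Proof. by have [] := zC y y. Qed.

Lemma center_assocl y w : op (op z y) w = op z (op y w).
Proof. by have [] := zC y w. Qed.

Lemma center_assocm y w : op (op y z) w = op y (op z w).
Proof. by have [] := zC y w. Qed.

Lemma center_assocr y w : op (op y w) z = op y (op w z).
Proof. by have [] := zC y w. Qed.

Lemma center_mulrAC y w : op (op y z) w = op (op y w) z.
Proof. by rewrite center_assocm centerC -center_assocr. Qed.

End Center.

Lemma neutral_center e : neutral op e -> loop_center op e.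
Proof. by move=> en y z; rewrite !(en _).1 !(en _).2. Qed.

Lemma central_two_cosets x :
  (forall y, loop_center op y \/ congruent (loop_center op) x y) ->
  loop_center op x.
Proof.
move=> cosets.
have xC y : op x y = op y x.
  case: (cosets y) => [yC|[c cC ->]]; first by rewrite (centerC yC).
  by rewrite center_assocm // (centerC cC).
have opC y w : op y w = op w y.
  case: (cosets y) => [yC|[c cC ->]]; first by rewrite (centerC yC).
  by rewrite center_assocm // (centerC cC) -!(center_assocr cC) xC.
have xxA w : op (op x x) w = op x (op x w).
  case: (cosets w) => [wC|[c cC ->]]; first by rewrite center_assocr.
  rewrite -(center_assocr cC) -xC -(center_assocr cC x x).
  by rewrite -(center_assocr cC).
have xA y w : op (op x y) w = op x (op y w).
  case: (cosets y) => [yC|[c cC ->]]; first by rewrite center_assocm.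
  rewrite -(center_assocr cC) (center_assocm cC (op x x)).
  by rewrite (center_assocm cC x w) xxA.
move=> y w; split=> //.
- by rewrite -(xC y) xA (opC y w) (opC y (op x w)) xA.
- by rewrite -xC -(xC w) (opC y (op x w)) xA (opC w).
Qed.

End LoopTheory.

Lemma loop_isomorphic_is_loop (T1 T2 : Type) (op1 : T1 -> T1 -> T1)
    (op2 : T2 -> T2 -> T2) :
  loop_isomorphic op1 op2 -> is_loop op1 -> is_loop op2.
Proof.
move=> [f [g fK gK] fM] L1.
have gM x y : g (op2 x y) = op1 (g x) (g y).
  by apply: (can_inj fK); rewrite fM !gK.
split.
- have [[e en] _ _] := L1; exists (f e) => x.
  by rewrite -[x]gK -!fM (en _).1 (en _).2.
- move=> a b; have [x xE] := loop_divl L1 (g a) (g b); exists (f x).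
  split=> [|y yE]; first by rewrite -[a]gK -fM xE gK.
  by apply/(can_inj gK)/(loop_cancell L1 (a := g a)); rewrite fK xE -gM yE.
- move=> a b; have [x xE] := loop_divr L1 (g a) (g b); exists (f x).
  split=> [|y yE]; first by rewrite -[a]gK -fM xE gK.
  by apply/(can_inj gK)/(loop_cancelr L1 (a := g a)); rewrite fK xE -gM yE.
Qed.

Lemma loop_isomorphic_nilpotent (T1 T2 : Type) (op1 : T1 -> T1 -> T1)
    (op2 : T2 -> T2 -> T2) :
  loop_isomorphic op1 op2 -> is_loop op1 ->
  loop_nilpotent op1 -> loop_nilpotent op2.
Proof.
move=> iso L1; have L2 := loop_isomorphic_is_loop iso L1.
have [f [g fK gK] fM] := iso; move=> [n nE]; exists n.
have upper_central_iso i x : upper_central op1 i x -> upper_central op2 i (f x).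
  elim: i x => [|i IHi] x.
    by move=> nx y; rewrite -[y]gK -!fM (nx _).1 (nx _).2.
  move=> /(upper_centralSP L1) cx; apply/(upper_centralSP L2) => y z N2.
  have congr_f a b : congruent op1 (upper_central op1 i) a b ->
      congruent op2 N2 (f a) (f b).
    by case=> m Nm ->; exists (f m); [apply: IHi | rewrite fM].
  have [/congr_f + /congr_f + /congr_f + /congr_f] := cx (g y) (g z).
  by rewrite !fM !gK.
apply/seteqP; split=> // x _.
by rewrite -[x]gK; apply: upper_central_iso; rewrite nE.
Qed.

HB.instance Definition _ (T : finType) (op : T -> T -> T)
    (N : set T) :=
  Finite.copy (loop_quo op N) (can_type (@loop_reprK T op N)).

Definition elements (T : finType) (N : set T) : {set T} := [set x | `[< N x >]].

Lemma elementsP (T : finType) (N : set T) x : reflect (N x) (x \in elements N).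
Proof. by rewrite inE; apply: asboolP. Qed.

Definition central_involution (T : Type) (op : T -> T -> T) (k : T) : Prop :=
  [/\ loop_center op k, ~ neutral op k & neutral op (op k k)].

Definition involution_subloop (T : Type) (op : T -> T -> T) (k : T) : set T :=
  fun x => neutral op x \/ x = k.

Section FiniteLoop.

Variables (T : finType) (op : T -> T -> T).
Hypothesis L : is_loop op.

Lemma card_saturated (N M : set T) : normal_subloop op N ->
  (forall x n, M x -> N n -> M (op x n)) ->
  #|elements M| = (#|loop_proj op N @: elements M| * #|elements N|)%N.
Proof.
move=> nN MN; rewrite -sum1_card (partition_big_imset (loop_proj op N)) /=.
rewrite -sum_nat_const; apply: eq_bigr => _ /imsetP[x /elementsP Mx ->].
have opI : injective (op x) by move=> y z; apply: loop_cancell.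
rewrite sum1dep_card -(card_imset (elements N) opI); apply: eq_card => y.
rewrite [LHS]inE.
apply/andP/imsetP => [[_ /eqP/esym/(eq_loop_projP L nN)[n Nn ->]]|[n]].
  by exists n => //; apply/elementsP.
move=> /elementsP Nn ->; split; first exact/elementsP/MN.
by apply/eqP/esym/(eq_loop_projP L nN); exists n.
Qed.

Lemma card_loop_quo (N : set T) : normal_subloop op N ->
  #|T| = (#|{: loop_quo op N}| * #|elements N|)%N.
Proof.
move=> nN; have := @card_saturated N (fun=> True) nN (fun _ _ _ _ => I).
have -> : elements (fun=> True) = [set: T].
  by apply/setP => x; rewrite !inE asboolT.
rewrite cardsT => ->; congr (_ * _)%N; rewrite -cardsT; apply: eq_card => A.
by rewrite inE -[A]loop_reprK imset_f.
Qed.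

Lemma card_normal_subloop_dvd (N M : set T) :
  normal_subloop op N -> normal_subloop op M -> (forall x, N x -> M x) ->
  (#|elements N| %| #|elements M|)%N.
Proof.
move=> nN nM NM; rewrite (card_saturated (M := M) nN) ?dvdn_mull // => x n Mx.
by move=> /NM Mn; apply/(normal_subloopMr nM).
Qed.

Lemma card_normal_subloop_dvdT (N : set T) :
  normal_subloop op N -> (#|elements N| %| #|T|)%N.
Proof. by move=> /card_loop_quo-> //; rewrite dvdn_mull. Qed.

Lemma card_upper_central_ltn i : loop_nilpotent op ->
  (#|elements (upper_central op i)| < #|T|)%N ->
  (#|elements (upper_central op i)| < #|elements (upper_central op i.+1)|)%N.
Proof.
move=> nil_op ltT; apply: proper_card; rewrite properE; apply/andP; split.
  by apply/subsetP => x /elementsP Zx; apply/elementsP/upper_centralS.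
apply: contraTN ltT => /subsetP sub; rewrite -leqNgt -cardsT subset_leq_card //.
apply/subsetP => x _; apply/elementsP/upper_central_stationary => // y Zy.
exact/elementsP/sub/elementsP.
Qed.

Lemma card_upper_central0 : #|elements (upper_central op 0)| = 1%N.
Proof.
have [[e en] _ _] := L; apply/eqP/cards1P; exists e; apply/setP => x.
rewrite in_set1; apply/elementsP/eqP => [nx|->//].
by rewrite -(nx e).2 (en x).1.
Qed.

Lemma card_center_neq_half : #|T| <> (2 * #|elements (loop_center op)|)%N.
Proof.
have nZ := loop_center_normal L; have [[e en] _ _] := L.
have eZ := neutral_center en.
rewrite (card_loop_quo nZ) => /eqP; rewrite eqn_pmul2r; last first.
  by apply/card_gt0P; exists e; apply/elementsP.
rewrite -cardsT => /eqP card_quo; set pe := loop_proj op (loop_center op) e.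
have /cards1P[A quoE] : #|[set~ pe]| == 1%N by rewrite cardsC1 -cardsT card_quo.
have projE y : loop_proj op (loop_center op) y = pe \/ loop_proj op _ y = A.
  have [->|neq] := eqVneq (loop_proj op (loop_center op) y) pe; first by left.
  by right; apply/set1P; rewrite -quoE !inE.
have xe : loop_proj op _ (loop_repr A) <> pe.
  by apply/eqP; rewrite loop_reprK -in_setC1 quoE inE.
set x := loop_repr A in xe.
case: xe; apply/esym/(eq_loop_projP L nZ); exists x; last by rewrite (en x).1.
apply: central_two_cosets => y.
case: (projE y); last rewrite -[A]loop_reprK; move=> /esym/(eq_loop_projP L nZ).
  by case=> c cC ->; left; rewrite (en c).1.
by right.
Qed.

End FiniteLoop.

(** * Nilpotent loops of order 2q *)

Section CentralInvolution.

Variables (T : Type) (op : T -> T -> T) (k : T).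
Hypotheses (L : is_loop op) (kP : central_involution op k).

Lemma central_involutionK x : op (op x k) k = x.
Proof. by have [kC _ kk] := kP; rewrite center_assocr // (kk x).2. Qed.

Lemma central_involution_neq x : op x k <> x.
Proof. by have [_ k1 _] := kP => /(neutral_unitl L). Qed.

Lemma involution_coset_eq x y :
  loop_coset op (involution_subloop op k) x =
  loop_coset op (involution_subloop op k) y <-> x = y \/ x = op y k.
Proof.
have [[e en] _ _] := L; split=> [xy|].
  have : loop_coset op (involution_subloop op k) x x.
    by exists e; [left | rewrite (en x).2].
  by rewrite xy => -[n [nn|->] <-]; [left; rewrite (nn y).2 | right].
case=> ->; first by [].
have sub u : (loop_coset op (involution_subloop op k) (op u k) `<=`
    loop_coset op (involution_subloop op k) u)%classic.
  move=> _ [n [nn|->] <-]; first by exists k; [right | rewrite (nn _).2].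
  by exists e; [left | rewrite central_involutionK (en u).2].
apply/seteqP; split; first exact: sub.
by rewrite -{1}[y]central_involutionK; apply: sub.
Qed.

Lemma involution_subloop_normal : normal_subloop op (involution_subloop op k).
Proof.
have [kC _ _] := kP; have [[e en] _ _] := L.
have quoE x y : loop_proj op (involution_subloop op k) x =
    loop_proj op (involution_subloop op k) y <-> x = y \/ x = op y k.
  by rewrite loop_projP involution_coset_eq.
have kcong : coset_congruence op (involution_subloop op k).
  split=> [x x' y y'|a x y|a x y]; rewrite !involution_coset_eq.
  - case=> ->; case=> ->; first by left.
    + by right; rewrite center_assocr.
    + by right; rewrite center_mulrAC.
    + by left; rewrite center_mulrAC // -center_assocr // central_involutionK.
  - by rewrite center_assocr // => -[|] /(loop_cancell L); [left | right].
  - by rewrite -center_mulrAC // => -[|] /(loop_cancelr L); [left | right].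
have QL := congruence_quo_loop L kcong; have mE := congruence_quo_mulE kcong.
exists _, (@loop_quo_mul _ op _), (loop_proj op (involution_subloop op k)).
split=> //; apply/seteqP; split=> x /= => [xN|nx].
  apply: (neutral_unitl (a := loop_proj op _ e) QL); rewrite mE (en x).1.
  apply/quoE; case: xN => [nx|->]; last by right; rewrite (en k).1.
  by left; rewrite -(nx e).2 (en x).1.
have := (nx (loop_proj op _ e)).2; rewrite mE (en x).1.
by case/quoE => ->; [left | right; rewrite (en k).1].
Qed.

End CentralInvolution.

Lemma card_involution_subloop (T : finType) (op : T -> T -> T) (k : T) :
  is_loop op -> central_involution op k ->
  #|elements (involution_subloop op k)| = 2%N.
Proof.
move=> L [_ k1 _]; have [[e en] _ _] := L.
have -> : elements (involution_subloop op k) = [set e; k].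
  apply/setP => x; rewrite in_set2; apply/elementsP/orP => [[nx|->]|].
  - by left; rewrite -(nx e).2 (en x).1.
  - by right.
  - by case=> /eqP->; [left | right].
by rewrite cards2; case: eqP k1 => // <-.
Qed.

Lemma assoc_loop_group (T : finType) (op : T -> T -> T) :
  is_loop op -> associative op ->
  exists gT : finGroupType, loop_isomorphic (@mulg gT) op.
Proof.
case: T op => T finT /= op L opA; have [[e en] _ _] := L.
have [inv invP] := choice (fun x => loop_divr L x e).
have ope : left_id e op by move=> x; rewrite (en x).1.
pose fT : finType := HB.pack T finT.
pose groupT := Finite_isGroup.Build fT opA ope invP.
pose gT : finGroupType := HB.pack T finT groupT.
by exists gT; exists id => //; exists id.
Qed.

Lemma assoc_loop_involution (T : finType) (op : T -> T -> T) :
  is_loop op -> associative op -> ~~ odd #|T| ->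
  exists2 k, ~ neutral op k & neutral op (op k k).
Proof.
move=> L opA; rewrite -dvdn2.
have [gT [f fbij fM]] := assoc_loop_group L opA.
rewrite -(bij_eq_card fbij) -cardsT => /(Cauchy (isT : prime 2))[g _ g2].
have f1 : neutral op (f 1%g).
  by have [f' _ f'K] := fbij => x; rewrite -[x]f'K -!fM mul1g mulg1.
exists (f g) => [/(_ (f 1%g))[fg1 _]|].
  have g1 : g = 1%g by apply: (bij_inj fbij); rewrite -fg1 (f1 _).2.
  by rewrite g1 order1 in g2.
by rewrite -fM -[(g * g)%g]/(g ^+ 2)%g -g2 expg_order.
Qed.

Lemma prime_assoc_loop_Fp (q : nat) (T : finType) (op : T -> T -> T) :
  prime q -> #|T| = q -> is_loop op -> associative op ->
  loop_isomorphic (@GRing.add 'F_q) op.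
Proof.
move=> q_pr Tq L opA; have [gT [f fbij fM]] := assoc_loop_group L opA.
have cardFq : #|[set: 'F_q]| = q by rewrite cardsT card_Fp.
have cardG : #|[set: gT]| = q by rewrite cardsT (bij_eq_card fbij).
have /isogP[h /injmP hI hG] : [set: 'F_q] \isog [set: gT].
  have Fq_cyclic : cyclic [set: 'F_q] by apply: prime_cyclic; rewrite cardFq.
  have G_cyclic : cyclic [set: gT] by apply: prime_cyclic; rewrite cardG.
  by rewrite isog_cyclic_card // G_cyclic cardG cardFq /=.
exists (f \o h) => [|x y /=]; last by rewrite -fM -morphM ?inE.
apply: bij_comp => //; apply: inj_card_bij => [x y|].
  by apply: hI; rewrite inE.
by rewrite -!cardsT cardFq cardG.
Qed.

Section NilpotentOrder2q.

Variables (T : finType) (op : T -> T -> T) (q : nat).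
Hypotheses (L : is_loop op) (nil_op : loop_nilpotent op).
Hypotheses (q_pr : prime q) (card_T : #|T| = (2 * q)%N).

Lemma card_center_order2q :
  #|elements (loop_center op)| = 2%N \/ forall x, loop_center op x.
Proof.
have nZ := loop_center_normal L; have half := card_center_neq_half L.
have Z_dvd := card_normal_subloop_dvdT L nZ; have q_gt1 := prime_gt1 q_pr.
have Z_gt1 : (1 < #|elements (loop_center op)|)%N.
  have := card_upper_central_ltn L (i := 0) nil_op.
  by rewrite card_upper_central0 // upper_central1 // card_T; apply; lia.
rewrite card_T in half Z_dvd.
have [q_dvd|q_ndvd] := boolP (q %| #|elements (loop_center op)|)%N; last first.
  left; apply/eqP; rewrite eqn_leq Z_gt1 andbT dvdn_leq //.
  by rewrite -(Gauss_dvdl _ (p := q)) // coprime_sym prime_coprime.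
right=> x; apply/elementsP.
suff -> : elements (loop_center op) = setT by rewrite inE.
apply/eqP; rewrite eqEcard subsetT cardsT card_T /=.
have /dvdnP[m card_Z] := q_dvd.
rewrite card_Z dvdn_pmul2r ?prime_gt0 // in half Z_dvd *.
have m_le2 : (m <= 2)%N by apply: dvdn_leq Z_dvd.
by case: m {card_Z q_dvd} half Z_dvd m_le2 => [|[|[|]]] //; lia.
Qed.

Lemma central_involution_of_center_full : (forall x, loop_center op x) ->
  exists2 k, central_involution op k
  & associative (@loop_quo_mul T op (involution_subloop op k)).
Proof.
move=> opZ; have opA : associative op by move=> x y z; rewrite center_assocl.
have [|k k1 kk] := assoc_loop_involution L opA.
  by rewrite card_T mul2n odd_double.
have kP : central_involution op k by [].
exists k => // A B C; rewrite -[A]loop_reprK -[B]loop_reprK -[C]loop_reprK.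
by rewrite !(loop_quo_mulE L (involution_subloop_normal L kP)) opA.
Qed.

Lemma central_involution_of_center2 : #|elements (loop_center op)| = 2%N ->
  exists2 k, central_involution op k
  & loop_center op = involution_subloop op k.
Proof.
move=> card_Z; have [[e en] _ _] := L; have nZ := loop_center_normal L.
have eZ : e \in elements (loop_center op) by apply/elementsP/neutral_center.
have neutralE x : neutral op x <-> x = e.
  by split=> [nx|->//]; rewrite -(nx e).2 (en x).1.
have /cards1P[k ZeE] : #|elements (loop_center op) :\ e| == 1%N.
  have := cardsD1 e (elements (loop_center op)).
  by rewrite eZ card_Z add1n => /succn_inj<-.
have kZe : k \in elements (loop_center op) :\ e by rewrite ZeE set11.
move: (kZe); rewrite in_setD1 => /andP[/eqP ke /elementsP kC].
have ZE : loop_center op = involution_subloop op k.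
  apply/seteqP; split=> x; last by case=> [xn|->//]; apply: neutral_center.
  move=> xC; have [->|xe] := eqVneq x e; first by left.
  by right; apply/set1P; rewrite -ZeE in_setD1 xe; apply/elementsP.
exists k => //; split; rewrite ?neutralE //.
have : loop_center op (op k k) by apply/(normal_subloopMr nZ).
by rewrite ZE => -[/neutralE//|/(neutral_unitl L)/neutralE].
Qed.

Lemma nilpotent_central_involution : exists2 k, central_involution op k
  & associative (@loop_quo_mul T op (involution_subloop op k)).
Proof.
have [card_Z|] := card_center_order2q; last first.
  exact: central_involution_of_center_full.
have [k kP ZE] := central_involution_of_center2 card_Z; exists k => //.
have Z1E := upper_central1 L.
have card_Z2 : #|elements (upper_central op 2)| = #|T|.
  have Z1_dvd := card_normal_subloop_dvd L (upper_central_normal 1 L)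
                   (upper_central_normal 2 L) (@upper_centralS _ _ L 1).
  have := card_upper_central_ltn L (i := 1) nil_op.
  have := card_normal_subloop_dvdT L (upper_central_normal 2 L).
  move: Z1_dvd; rewrite Z1E card_Z card_T => /dvdnP[m ->].
  rewrite mulnC dvdn_pmul2l // => /(primeP q_pr).2/orP[]/eqP-> //.
  by have := prime_gt1 q_pr; lia.
have Z2_full : elements (upper_central op 2) = setT.
  by apply/eqP; rewrite eqEcard subsetT cardsT card_Z2 /=.
rewrite -ZE -Z1E => A B C; apply/esym/center_assocl; rewrite -[A]loop_reprK.
by apply/(elementsP (upper_central op 2)); rewrite Z2_full inE.
Qed.

End NilpotentOrder2q.

(** * Cocycles and central extensions *)

Definition central_ext (A Q : zmodType) (f : Q * Q -> A) (u v : A * Q) :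
  A * Q := (u.1 + v.1 + f (u.2, v.2), u.2 + v.2).

Section CentralExtension.

Variables (A Q : zmodType) (f : Q * Q -> A).
Hypotheses (f_r0 : forall x, f (x, 0) = 0) (f_l0 : forall x, f (0, x) = 0).

Lemma central_ext_loop : is_loop (central_ext f).
Proof.
split.
- exists (0, 0) => -[a x].
  by rewrite /central_ext /= f_r0 f_l0 !add0r !addr0.
- move=> [a x] [b y]; exists (b - f (x, y - x) - a, y - x); split.
    by rewrite /central_ext /= !(addrC _ (_ - _)) !subrK.
  case=> c z; rewrite /central_ext /= => -[<- <-].
  by rewrite (addrC x z) !addrK addrAC subrr add0r.
- move=> [a x] [b y]; exists (b - f (y - x, x) - a, y - x); split.
    by rewrite /central_ext /= !subrK.
  by case=> c z; rewrite /central_ext /= => -[<- <-]; rewrite !addrK.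
Qed.

Lemma central_ext_center a : loop_center (central_ext f) (a, 0).
Proof.
move=> [b y] [c z]; rewrite /central_ext /= !f_r0 !f_l0 !add0r !addr0.
by split; congr (_, _); rewrite ?addrA //; [apply: addrC | apply: addrAC].
Qed.

Lemma central_ext_nilpotent : loop_nilpotent (central_ext f).
Proof.
have L := central_ext_loop.
have congr_proj u v : u.2 = v.2 ->
    congruent (central_ext f) (upper_central (central_ext f) 1) u v.
  move=> uv; exists (v.1 - u.1, 0).
    by rewrite upper_central1 //; apply: central_ext_center.
  by rewrite /central_ext /= f_r0 !addr0 addrC subrK uv; case: v {uv}.
exists 2; apply/seteqP; split=> // x _; apply/(upper_centralSP L) => y z N.
by split; apply: congr_proj => /=; rewrite ?addrA // addrC.
Qed.

End CentralExtension.

Definition cocycle (F : finFieldType) := {ffun F * F -> bool}.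

Definition free_pairs (F : finFieldType) : {set F * F} :=
  [set z | [&& z.1 != 0, z.2 != 0 & z.1 != z.2]].

Definition normal_cocycles (F : finFieldType) : {set cocycle F} :=
  [set f in pffun_on false (free_pairs F) predT].

Definition split_cocycle (F : finFieldType) (a b c : F -> bool) : cocycle F :=
  [ffun z => a z.1 + b z.2 + c (z.1 + z.2)].

(* In characteristic 2 the coboundary of x |-> h(x/2, x/2) takes the value
   h(x, x) at (x, x), so adding it clears the diagonal. *)
Definition normalize (F : finFieldType) (f : cocycle F) : cocycle F :=
  let h x y := f (x, y) + f (x, 0) + f (0, y) + f (0, 0) in
  let d x := h (x / 2) (x / 2) in
  [ffun z => h z.1 z.2 + d z.1 + d z.2 + d (z.1 + z.2)].

Lemma normalize_is_zmod_morphism (F : finFieldType) :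
  {morph @normalize F : f g / f - g}.
Proof. by move=> f g; apply/ffunP => z; rewrite !ffunE /=; ring. Qed.

HB.instance Definition _ (F : finFieldType) :=
  GRing.isZmodMorphism.Build (cocycle F) (cocycle F) (@normalize F)
    (@normalize_is_zmod_morphism F).

Lemma normal_cocycleP (F : finFieldType) (f : cocycle F) :
  f \in normal_cocycles F <->
  [/\ forall x, f (x, 0) = 0, forall y, f (0, y) = 0 & forall x, f (x, x) = 0].
Proof.
rewrite inE; split=> [/pffun_onP[/supportP f0 _]|[fr0 fl0 fxx]].
  by split=> x; apply: f0; rewrite inE /= ?eqxx ?andbF.
apply/pffun_onP; split=> //; apply/subsetP => -[x y]; rewrite !inE /=.
apply: contraR; rewrite !negb_and !negbK.
by case/or3P => /eqP->; rewrite ?fr0 ?fl0 ?fxx.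
Qed.

Section NormalForm.

Variable F : finFieldType.
Hypothesis two_neq0 : 2 != 0 :> F.

Lemma halfD (x : F) : x / 2 + x / 2 = x.
Proof. by rewrite -mulr2n -[_ *+ 2]mulr_natr divfK. Qed.

Lemma double_eq0 (x : F) : x + x = 0 -> x = 0.
Proof.
move/eqP; rewrite -mulr2n -mulr_natr mulf_eq0 (negbTE two_neq0) orbF.
by move/eqP.
Qed.

Lemma normalize_normal (f : cocycle F) : normalize f \in normal_cocycles F.
Proof.
apply/normal_cocycleP; split=> x; rewrite ffunE /= ?mulr0 ?mul0r ?add0r ?addr0.
- by move: (f (x, 0)) (f (0, 0)) (f (x / 2, x / 2)) (f (x / 2, 0))
    (f (0, x / 2)); do 5!case.
- by move: (f (0, x)) (f (0, 0)) (f (x / 2, x / 2)) (f (x / 2, 0))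
    (f (0, x / 2)); do 5!case.
- rewrite mulrDl halfD.
  by move: (f (x, x)) (f (x, 0)) (f (0, x)) (f (0, 0)) (f (x / 2, x / 2))
    (f (x / 2, 0)) (f (0, x / 2)); do 7!case.
Qed.

Lemma normalize_id (f : cocycle F) : f \in normal_cocycles F -> normalize f = f.
Proof.
move=> /normal_cocycleP[fr0 fl0 fxx]; apply/ffunP => -[x y].
by rewrite ffunE /= !fr0 !fl0 !fxx !addr0.
Qed.

Lemma normalize_split (a b c : F -> bool) : normalize (split_cocycle a b c) = 0.
Proof.
pose f := split_cocycle a b c.
have mixed x y : f (x, y) + f (x, 0) + f (0, y) + f (0, 0) =
    c (x + y) + c x + c y + c 0.
  rewrite !ffunE /= !addr0 !add0r.
  by move: (a x) (a 0) (b y) (b 0) (c (x + y)) (c x) (c y) (c 0); do 8!case.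
apply/ffunP => -[x y]; rewrite ffunE /= !mixed !halfD ffunE.
by move: (c (x + y)) (c x) (c y) (c 0) (c (x / 2)) (c (y / 2))
  (c ((x + y) / 2)); do 7!case.
Qed.

Lemma sub_normalize (f : cocycle F) :
  exists a b c, f - normalize f = split_cocycle a b c.
Proof.
pose d x := f (x / 2, x / 2) + f (x / 2, 0) + f (0, x / 2) + f (0, 0).
exists (fun x => - (f (x, 0) + d x)), (fun y => - (f (0, y) + f (0, 0) + d y)).
exists (fun x => - d x).
apply/ffunP => -[x y]; rewrite !ffunE /= /d; ring.
Qed.

Lemma normalize_eqP (f g : cocycle F) :
  normalize f = normalize g <-> exists a b c, f = g + split_cocycle a b c.
Proof.
split=> [fg|[a [b [c ->]]]]; last by rewrite raddfD /= normalize_split addr0.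
have [a [b [c fgE]]] := sub_normalize (f - g); exists a, b, c.
by rewrite -fgE raddfB /= fg subrr subr0 addrC subrK.
Qed.

Section Extension.

Variables (T : finType) (op : T -> T -> T) (k : T) (p : T -> F).
Hypotheses (L : is_loop op) (kP : central_involution op k).
Hypotheses (pM : forall x y, p (op x y) = p x + p y)
  (p_surj : forall i, exists x, p x = i)
  (p_ker : forall x y, p x = p y <-> x = y \/ x = op y k).

Let shift (b : bool) x := if b then op x k else x.

Let shiftM a b x y : op (shift a x) (shift b y) = shift (a + b) (op x y).
Proof.
have [kC _ _] := kP; have kK := central_involutionK kP.
have kMl u v : op (op u k) v = op (op u v) k by rewrite center_mulrAC.
have kMr u v : op u (op v k) = op (op u v) k by rewrite center_assocr.
by case: a; case: b; rewrite /= ?kMl ?kMr ?kK.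
Qed.

Let shiftD a b x : shift (a + b) x = shift a (shift b x).
Proof.
by have kK := central_involutionK kP; case: a; case: b; rewrite /= ?kK.
Qed.

Let p_shift b x : p (shift b x) = p x.
Proof. by case: b => //; apply/p_ker; right. Qed.

(* Both elements of a fibre of p have the same square, and the section choosing
   the unique square in each fibre is normalized on the diagonal. *)
Let square_section : exists2 s : F -> T, (forall i, p (s i) = i)
  & neutral op (s 0) /\ forall i, op (s i) (s i) = s (i + i).
Proof.
have [r rK] := choice p_surj; have [[e en] _ _] := L.
have pe : p e = 0 by apply: (addrI (p e)); rewrite -pM (en e).1 addr0.
have square_fibre x y : p x = p y -> op x x = op y y.
  move=> /p_ker[->//|->]; rewrite -[op y k]/(shift true y).
  by rewrite shiftM.
pose s i := op (r (i / 2)) (r (i / 2)); exists s => [i|].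
  by rewrite pM !rK halfD.
have s0 : s 0 = e by rewrite /s mul0r (square_fibre _ e) ?rK ?(en e).1.
split=> [|i]; first by rewrite s0.
by apply: square_fibre; rewrite pM !rK mulrDl !halfD.
Qed.

Lemma extension_isomorphic :
  exists2 f : cocycle F, f \in normal_cocycles F
  & loop_isomorphic (central_ext f) op.
Proof.
have [s sK [s0 sD]] := square_section.
have k_free := central_involution_neq L kP.
pose f : cocycle F := [ffun z => op (s z.1) (s z.2) != s (z.1 + z.2)].
have sM i j : op (s i) (s j) = shift (f (i, j)) (s (i + j)).
  rewrite ffunE /=; case: eqP => //= neq.
  by case: (p_ker (op (s i) (s j)) (s (i + j))).1 => //; rewrite pM !sK.
exists f.
  apply/normal_cocycleP; split=> i; rewrite ffunE /= ?addr0 ?add0r;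
    by rewrite ?(s0 _).1 ?(s0 _).2 ?sD ?eqxx.
exists (fun u : bool * F => shift u.1 (s u.2)) => [|[a i] [b j] /=]; last first.
  by rewrite shiftM sM -shiftD.
exists (fun x => (s (p x) != x, p x)) => [[b i]|x] /=.
  rewrite p_shift sK; congr (_, _); case: b => /=; last by rewrite eqxx.
  by rewrite eq_sym; apply/eqP/k_free.
case: eqP => //= neq.
have /p_ker[xE|<-//] : p x = p (s (p x)) by rewrite sK.
by case: neq; rewrite -xE.
Qed.

End Extension.

End NormalForm.

Lemma Fp_two_neq0 q : prime q -> odd q -> 2 != 0 :> 'F_q.
Proof.
move=> q_pr q_odd; rewrite -(dvdn_pcharf (pchar_Fp q_pr)).
by rewrite dvdn_prime2 //; apply: contraTneq q_odd => ->.
Qed.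

Lemma nilpotent_loop_central_ext q (T : finType) (op : T -> T -> T) :
  prime q -> odd q -> #|T| = (2 * q)%N -> is_loop op -> loop_nilpotent op ->
  exists2 f : cocycle 'F_q, f \in normal_cocycles 'F_q
  & loop_isomorphic (central_ext f) op.
Proof.
move=> q_pr q_odd card_T L nil_op.
have [k kP quoA] := nilpotent_central_involution L nil_op q_pr card_T.
have nK := involution_subloop_normal L kP; have QL := loop_quo_loop L nK.
have card_Q : #|{: loop_quo op (involution_subloop op k)}| = q.
  apply/eqP; rewrite -(eqn_pmul2r (isT : 0 < 2)%N) [(q * 2)%N]mulnC -card_T.
  by rewrite (card_loop_quo L nK) card_involution_subloop.
have [psi [psi' psiK psiK'] psiM] := prime_assoc_loop_Fp q_pr card_Q QL quoA.
pose p x := psi' (loop_proj op (involution_subloop op k) x).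
have two_neq0 := Fp_two_neq0 q_pr q_odd.
apply: (extension_isomorphic two_neq0 (p := p) L kP) => [x y|i|x y].
- by apply: (can_inj psiK); rewrite psiM !psiK' loop_quo_mulE.
- by exists (loop_repr (psi i)); rewrite /p loop_reprK psiK.
- rewrite -(involution_coset_eq L kP) -loop_projP; split=> [|xy].
    by apply: (can_inj psiK').
  by rewrite /p xy.
Qed.

(** * Action of the dilations on normal cocycles *)

Definition dilation (F : finFieldType) : Type := ({unit F} * (F * F))%type.

Section DilationGroup.

Variable F : finFieldType.

HB.instance Definition _ := Finite.on (dilation F).

Definition dilation_mul (d e : dilation F) : dilation F :=
  ((d.1 * e.1)%g, (val e.1 * d.2.1 + e.2.1, val e.1 * d.2.2 + e.2.2)).

Definition dilation_one : dilation F := (1%g, (0, 0)).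

Definition dilation_inv (d : dilation F) : dilation F :=
  (d.1^-1%g, (- (d.2.1 / val d.1), - (d.2.2 / val d.1))).

Lemma unit_neq0 (u : {unit F}) : val u != 0.
Proof. by rewrite -unitfE; apply: valP. Qed.

Lemma dilation_mulA : associative dilation_mul.
Proof.
move=> [u [s t]] [u' [s' t']] [u'' [s'' t'']]; rewrite /dilation_mul /= mulgA.
by congr (_, (_, _)); ring.
Qed.

Lemma dilation_mul1 : left_id dilation_one dilation_mul.
Proof. by case=> u [s t]; rewrite /dilation_mul /= mul1g !mulr0 !add0r. Qed.

Lemma dilation_mulV : left_inverse dilation_one dilation_inv dilation_mul.
Proof.
case=> u [s t]; rewrite /dilation_mul /= mulVg.
by congr (_, (_, _)); field; apply: unit_neq0.
Qed.

HB.instance Definition _ := Finite_isGroup.Build (dilation F)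
  dilation_mulA dilation_mul1 dilation_mulV.

Definition dilate (z : F * F) (d : dilation F) : F * F :=
  (val d.1 * z.1 + d.2.1, val d.1 * z.2 + d.2.2).

Lemma dilate_is_action : is_action [set: dilation F] dilate.
Proof.
split=> [d [x y] [x' y'] /= [] | z d e _ _].
  by move=> /addIr/(mulfI (unit_neq0 _))-> /addIr/(mulfI (unit_neq0 _))->.
by congr (_, _); rewrite /=; ring.
Qed.

Canonical dilation_action : {action dilation F &-> F * F} :=
  Action dilate_is_action.

Definition translation (s t : F) : dilation F := (1%g, (s, t)).

Definition homothety (u : {unit F}) : dilation F := (u, (0, 0)).

Lemma homothetyM : {in [set: {unit F}] &, {morph homothety : u v / (u * v)%g}}.
Proof. by move=> u v _ _; congr (_, (_, _)); rewrite mulr0 addr0. Qed.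

Canonical homothety_morphism := Morphism homothetyM.

Lemma injm_homothety : 'injm homothety.
Proof. by apply/injmP => u v _ _ []. Qed.

(* A dilation of ratio u <> 1 has the centre (s / (1 - u), t / (1 - u)). *)
Lemma conj_homothety (d : dilation F) : d.1 != 1%g ->
  exists e, d = (homothety d.1 ^ e)%g.
Proof.
case: d => u [s t] /= u_neq1.
have subu_neq0 : 1 - val u != 0.
  by rewrite subr_eq0; apply: contraNneq u_neq1 => uE; apply/eqP/val_inj.
exists (translation (s / (1 - val u)) (t / (1 - val u))).
rewrite /conjg /mulg /invg /= /dilation_mul /= invg1 mulg1 mul1g !divr1.
by congr (_, (_, _)); field.
Qed.

End DilationGroup.

Local Notation cocycle_act := (ffun_act (dilation_action _)).
Local Notation homotheties F := (@homothety F @* [set: {unit F}]).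

Section ClassAction.

Variable F : finFieldType.
Hypothesis two_neq0 : 2 != 0 :> F.

Lemma cocycle_act_split (a b c : F -> bool) (d : dilation F) :
  exists a' b' c',
    cocycle_act (split_cocycle a b c) d = split_cocycle a' b' c'.
Proof.
pose e := (d^-1)%g; exists (fun x => a (val e.1 * x + e.2.1)).
exists (fun y => b (val e.1 * y + e.2.2)).
exists (fun x => c (val e.1 * x + (e.2.1 + e.2.2))).
by apply/ffunP => z; rewrite !ffunE /=; congr (_ + c _); ring.
Qed.

Lemma eq_normalize_cocycle_act (f g : cocycle F) (d : dilation F) :
  normalize f = normalize g ->
  normalize (cocycle_act f d) = normalize (cocycle_act g d).
Proof.
move=> /(normalize_eqP two_neq0)[a [b [c ->]]]; apply/(normalize_eqP two_neq0).
have [a' [b' [c' splitE]]] := cocycle_act_split a b c d; exists a', b', c'.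
by rewrite -splitE; apply/ffunP => z; rewrite !ffunE.
Qed.

Definition normal_cocycle := {f : cocycle F | f \in normal_cocycles F}.

Definition normal_form (f : cocycle F) : normal_cocycle :=
  exist _ (normalize f) (normalize_normal two_neq0 f).

Definition class_act (f : normal_cocycle) (d : dilation F) : normal_cocycle :=
  normal_form (cocycle_act (val f) d).

Lemma class_act1 : class_act^~ 1%g =1 id.
Proof.
move=> f; apply: val_inj.
by rewrite /= (act1 (ffun_action _ _)) normalize_id ?(valP f).
Qed.

Lemma class_actM f : act_morph class_act f.
Proof.
move=> d e; apply: val_inj; rewrite /= (actM (ffun_action bool _)).
apply: eq_normalize_cocycle_act.
by rewrite /= (normalize_id (normalize_normal _ _)).
Qed.

Canonical class_action : {action dilation F &-> normal_cocycle} :=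
  TotalAction class_act1 class_actM.

End ClassAction.

(** * Isotopisms *)

Lemma pexider (U V : zmodType) (a b c : U -> V) :
  (forall x y, a x + b y = c (x + y)) ->
  exists2 h : U -> V, {morph h : x y / x + y}
  & forall x, [/\ a x = h x + a 0, b x = h x + b 0 & c x = h x + (a 0 + b 0)].
Proof.
move=> abc; pose h x := c x - (a 0 + b 0).
have aE x : a x = h x + a 0.
  by rewrite /h -[in c x](addr0 x) -abc opprD addrA addrAC addrK subrK.
have bE x : b x = h x + b 0.
  by rewrite /h -[in c x](add0r x) -abc opprD addrA (addrC (a 0)) addrK subrK.
have cE x : c x = h x + (a 0 + b 0) by rewrite /h subrK.
exists h => // x y; apply: (addIr (a 0 + b 0)).
by rewrite -cE -abc aE bE addrACA.
Qed.

Lemma Fp_additive q (h : 'F_q -> 'F_q) : {morph h : x y / x + y} ->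
  forall x, h x = h 1 * x.
Proof.
move=> hD x; have h0 : h 0 = 0 by apply: (addrI (h 0)); rewrite -hD !addr0.
rewrite -[x]natr_Zp mulr_natr; elim: (nat_of_ord x) => [|n IHn].
  by rewrite !mulr0n.
by rewrite !mulrS hD IHn.
Qed.

Definition flip (F : finFieldType) (u : bool * F) : bool * F := (u.1 + 1, u.2).

Section Isotopisms.

Variables (F : finFieldType) (f g : cocycle F).
Hypotheses (two_neq0 : 2 != 0 :> F) (gN : g \in normal_cocycles F).

Lemma flipK : involutive (@flip F).
Proof. by case=> -[] x. Qed.

Lemma central_ext_flipl (h : cocycle F) u v :
  central_ext h (flip u) v = flip (central_ext h u v).
Proof. by rewrite /central_ext /flip /=; congr (_, _); ring. Qed.

Lemma central_ext_flipr (h : cocycle F) u v :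
  central_ext h u (flip v) = flip (central_ext h u v).
Proof. by rewrite /central_ext /flip /=; congr (_, _); ring. Qed.

Lemma central_ext_neutral : neutral (central_ext g) (0, 0).
Proof.
have [gr0 gl0 _] := (normal_cocycleP g).1 gN; case=> b x.
by rewrite /central_ext /= gr0 gl0 !add0r !addr0.
Qed.

Lemma eq_flip (phi : bool * F -> bool * F) :
  involutive phi -> (forall u, phi u <> u) ->
  (forall u v, central_ext g u (phi v) = phi (central_ext g u v)) ->
  phi =1 @flip F.
Proof.
move=> phiK phi_free phiM; have en := central_ext_neutral.
have phi0_snd : (phi (0, 0)).2 = 0.
  apply: (double_eq0 two_neq0); have := phiM (phi (0, 0)) (0, 0).
  by rewrite (en _).2 phiK => /(congr1 snd).
have phi0 : phi (0, 0) = flip (0, 0).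
  have := phi_free (0, 0); move: phi0_snd.
  by case: (phi (0, 0)) => -[] x /= ->.
by move=> u; rewrite -{1}(en u).2 -phiM phi0 central_ext_flipr (en u).2.
Qed.

Variables alpha beta gamma : bool * F -> bool * F.
Hypotheses (alpha_bij : bijective alpha) (beta_bij : bijective beta).
Hypothesis (gamma_bij : bijective gamma).
Hypothesis isoM : forall u v,
  central_ext g (alpha u) (beta v) = gamma (central_ext f u v).

(* The conjugate of flip by gamma commutes with left and right multiplications,
   hence is itself multiplication by a central element of order 2. *)
Lemma isotopism_flip :
  [/\ forall u, alpha (flip u) = flip (alpha u),
      forall u, beta (flip u) = flip (beta u)
    & forall u, gamma (flip u) = flip (gamma u)].
Proof.
have en := central_ext_neutral.
have [[alpha' alphaK alphaK'] [beta' betaK betaK'] [gamma' gammaK gammaK']] :=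
  And3 alpha_bij beta_bij gamma_bij.
pose phi u := gamma (flip (gamma' u)).
have phi_alpha u v : central_ext g (alpha (flip u)) (beta v) =
    phi (central_ext g (alpha u) (beta v)).
  by rewrite isoM central_ext_flipl isoM /phi gammaK.
have phi_beta u v : central_ext g (alpha u) (beta (flip v)) =
    phi (central_ext g (alpha u) (beta v)).
  by rewrite isoM central_ext_flipr isoM /phi gammaK.
have alphaE u : alpha (flip u) = phi (alpha u).
  by have := phi_alpha u (beta' (0, 0)); rewrite betaK' !(en _).2.
have betaE u : beta (flip u) = phi (beta u).
  by have := phi_beta (alpha' (0, 0)) u; rewrite alphaK' !(en _).1.
have phiE : phi =1 @flip F.
  apply: eq_flip => [u|u|u v].
  - by rewrite /phi gammaK flipK gammaK'.
  - by move/(congr1 gamma'); rewrite gammaK; case: (gamma' u) => -[].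
  - by rewrite -[u]alphaK' -[v]betaK' -betaE phi_beta.
split=> u; first by rewrite alphaE phiE.
  by rewrite betaE phiE.
by rewrite -[RHS]phiE /phi gammaK.
Qed.

Lemma isotopism_snd : exists2 h : F -> F, {morph h : x y / x + y} & forall u,
  [/\ (alpha u).2 = h u.2 + (alpha (0, 0)).2,
      (beta u).2 = h u.2 + (beta (0, 0)).2
    & (gamma u).2 = h u.2 + ((alpha (0, 0)).2 + (beta (0, 0)).2)].
Proof.
have [alphaF betaF gammaF] := isotopism_flip.
have snd0 (k : bool * F -> bool * F) : (forall u, k (flip u) = flip (k u)) ->
    forall u, (k u).2 = (k (0, u.2)).2.
  by move=> kF [[] x] //; rewrite -[(true, x)]/(flip (0, x)) kF.
have [x y|h hD hE] := @pexider _ _ (fun x => (alpha (0, x)).2)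
    (fun y => (beta (0, y)).2) (fun x => (gamma (0, x)).2).
  have := congr1 snd (isoM (0, x) (0, y)).
  by rewrite (snd0 _ gammaF (central_ext _ _ _)).
by exists h => // u; rewrite (snd0 _ alphaF) (snd0 _ betaF) (snd0 _ gammaF).
Qed.

Lemma isotopism_fst x y :
  g ((alpha (0, x)).2, (beta (0, y)).2) =
  f (x, y) + ((gamma (0, x + y)).1 - (alpha (0, x)).1 - (beta (0, y)).1).
Proof.
have [_ _ gammaF] := isotopism_flip.
have gamma_fst b z : (gamma (b, z)).1 = b + (gamma (0, z)).1.
  by case: b => //; rewrite -[(true, z)]/(flip (0, z)) gammaF /= addrC.
have := congr1 fst (isoM (0, x) (0, y)).
rewrite /central_ext /= !add0r gamma_fst => /(canRL (addKr _)) ->.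
by ring.
Qed.

End Isotopisms.

Lemma isotopism_dilation q (f g : cocycle 'F_q)
    (alpha beta gamma : bool * 'F_q -> bool * 'F_q) :
  2 != 0 :> 'F_q -> g \in normal_cocycles 'F_q ->
  bijective alpha -> bijective beta -> bijective gamma ->
  (forall u v, central_ext g (alpha u) (beta v) = gamma (central_ext f u v)) ->
  exists d : dilation 'F_q,
    [/\ forall u, (alpha u).2 = val d.1 * u.2 + d.2.1,
        forall u, (beta u).2 = val d.1 * u.2 + d.2.2,
        forall u, (gamma u).2 = val d.1 * u.2 + (d.2.1 + d.2.2)
      & normalize f = normalize (cocycle_act g d^-1%g)].
Proof.
move=> two_neq0 gN alpha_bij beta_bij gamma_bij isoM.
have [h /Fp_additive hE abcE] :=
  isotopism_snd two_neq0 gN alpha_bij beta_bij gamma_bij isoM.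
have h1_neq0 : h 1 != 0.
  have [alpha' _ alphaK'] := alpha_bij; apply/eqP => h1.
  have := congr1 snd (alphaK' (0, (alpha (0, 0)).2 + 1)).
  have [-> _ _] := abcE (alpha' (0, (alpha (0, 0)).2 + 1)).
  by rewrite hE h1 mul0r addrC => /addrI/eqP; rewrite eq_sym oner_eq0.
pose u0 : {unit 'F_q} := FinRing.unit 'F_q (etrans (unitfE _) h1_neq0).
pose d : dilation 'F_q := (u0, ((alpha (0, 0)).2, (beta (0, 0)).2)).
exists d; split=> [u|u|u|].
1-3: by have [] := abcE u; rewrite hE.
apply/esym/(normalize_eqP two_neq0); exists (fun x => - (alpha (0, x)).1).
exists (fun y => - (beta (0, y)).1), (fun x => (gamma (0, x)).1).
apply/ffunP => -[x y]; rewrite !ffunE invgK /dilate /=.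
have [alphaE _ _] := abcE (0, x); have [_ betaE _] := abcE (0, y).
have := isotopism_fst two_neq0 gN alpha_bij beta_bij gamma_bij isoM x y.
by rewrite alphaE betaE !(hE x) (hE y) => ->; ring.
Qed.

Lemma dilation_isotopic (F : finFieldType) (f g : cocycle F) (d : dilation F) :
  2 != 0 :> F ->
  normalize f = normalize (cocycle_act g d^-1%g) ->
  isotopic (central_ext f) (central_ext g).
Proof.
move=> two_neq0 /esym/(normalize_eqP two_neq0)[a [b [c fgE]]].
have gE x y : g (dilate (x, y) d) = f (x, y) + (a x + b y + c (x + y)).
  by have /ffunP/(_ (x, y)) := fgE; rewrite !ffunE invgK.
have shear_bij (k : F -> bool) s :
    bijective (fun u : bool * F => (u.1 + k u.2, val d.1 * u.2 + s)).
  exists (fun u => (u.1 - k ((u.2 - s) / val d.1), (u.2 - s) / val d.1));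
    move=> [e x] /=.
    by rewrite addrK mulrC mulKf ?unit_neq0 // addrK.
  by rewrite mulrCA divff ?unit_neq0 // mulr1 subrK addrNK.
exists (fun u => (u.1 - a u.2, val d.1 * u.2 + d.2.1)).
exists (fun u => (u.1 - b u.2, val d.1 * u.2 + d.2.2)).
exists (fun u => (u.1 + c u.2, val d.1 * u.2 + (d.2.1 + d.2.2))).
split; [exact: shear_bij .. |] => -[e x] [e' y].
rewrite /central_ext /=; congr (_, _); last by ring.
by rewrite [g _]gE; ring.
Qed.

Lemma homothety_actE (F : finFieldType) (f : cocycle F) (u : {unit F}) x y :
  cocycle_act f (homothety u) (x, y) = f (x / val u, y / val u).
Proof.
by rewrite ffunE -morphV ?inE //= /dilate /= !addr0 !(mulrC (val u)^-1).
Qed.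

Lemma homothety_act_normal (F : finFieldType) (f : cocycle F) (u : {unit F}) :
  f \in normal_cocycles F ->
  cocycle_act f (homothety u) \in normal_cocycles F.
Proof.
move=> /normal_cocycleP[fr0 fl0 fxx]; apply/normal_cocycleP.
by split=> x; rewrite homothety_actE ?mul0r.
Qed.

Lemma mem_orbit_isotopic q (two_neq0 : 2 != 0 :> 'F_q)
    (f g : normal_cocycle 'F_q) :
  g \in orbit (class_action two_neq0) [set: dilation 'F_q] f <->
  isotopic (central_ext (val f)) (central_ext (val g)).
Proof.
rewrite orbit_sym; split=> [/orbitP[d _ <-]|].
  apply: (dilation_isotopic (d := d^-1%g) two_neq0); rewrite invgK.
  exact/normalize_id/normalize_normal.
move=> [alpha [beta [gamma [alpha_bij beta_bij gamma_bij isoM]]]].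
have [d [_ _ _ fE]] :=
  isotopism_dilation two_neq0 (valP g) alpha_bij beta_bij gamma_bij isoM.
apply/orbitP; exists d^-1%g; rewrite ?inE //.
by apply: val_inj; rewrite /= -fE (normalize_id (valP f)).
Qed.

Lemma mem_orbit_isomorphic q (two_neq0 : 2 != 0 :> 'F_q)
    (f g : normal_cocycle 'F_q) :
  g \in orbit (class_action two_neq0) (homotheties 'F_q) f <->
  loop_isomorphic (central_ext (val f)) (central_ext (val g)).
Proof.
rewrite orbit_sym; split=> [/orbitP[_ /morphimP[u _ _ ->] fE]|[h h_bij hM]].
  have {}fE : val f = cocycle_act (val g) (homothety u).
    by rewrite -fE /= normalize_id // homothety_act_normal // (valP g).
  exists (fun v => (v.1, v.2 / val u)) => [|[b x] [c y]].
    exists (fun v => (v.1, v.2 * val u)) => -[b x] /=.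
      by rewrite divfK ?unit_neq0.
    by rewrite mulfK ?unit_neq0.
  by rewrite /central_ext /= fE homothety_actE mulrDl.
have isoM u v := esym (hM u v).
have [[u [s t]] [hs ht hst fE]] :=
  isotopism_dilation two_neq0 (valP g) h_bij h_bij h_bij isoM.
have /addrI /= s_eq_st := etrans (esym (hs 0)) (hst 0).
have /addrI /= s_eq_t := etrans (esym (hs 0)) (ht 0).
have t0 : t = 0 by apply: (addrI s); rewrite addr0 -s_eq_st.
have s0 : s = 0 by rewrite s_eq_t.
have dE : (u, (s, t)) = homothety u by rewrite s0 t0.
apply/orbitP; exists (homothety u)^-1%g.
  by rewrite groupV mem_morphim ?inE.
by apply: val_inj; rewrite /= -dE -fE (normalize_id (valP f)).
Qed.

Lemma isomorphic_table (T : finType) (op : T -> T -> T) n : #|T| = n ->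
  exists t : mul_table n, loop_isomorphic op (table_op t).
Proof.
move=> <-; exists [ffun z => enum_rank (op (enum_val z.1) (enum_val z.2))].
exists enum_rank => [|x y]; first exact: enum_rank_bij.
by rewrite /table_op ffunE /= !enum_rankK.
Qed.

Lemma loop_isomorphic_isotopic (T1 T2 : Type) (op1 : T1 -> T1 -> T1)
    (op2 : T2 -> T2 -> T2) : loop_isomorphic op1 op2 -> isotopic op1 op2.
Proof. by move=> [f f_bij fM]; exists f, f, f; split=> // x y; rewrite fM. Qed.

Section NilpotentClasses.

Variable q : nat.
Hypotheses (q_pr : prime q) (q_odd : odd q).

Let two_neq0 := Fp_two_neq0 q_pr q_odd.

Section OrbitClasses.

Variable equiv : forall T1 T2 : Type,
  (T1 -> T1 -> T1) -> (T2 -> T2 -> T2) -> Prop.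
Hypothesis equiv_sym : forall (T1 T2 : Type) (op1 : T1 -> T1 -> T1)
  (op2 : T2 -> T2 -> T2), equiv op1 op2 -> equiv op2 op1.
Hypothesis equiv_trans : forall (T1 T2 T3 : Type) (op1 : T1 -> T1 -> T1)
  (op2 : T2 -> T2 -> T2) (op3 : T3 -> T3 -> T3),
  equiv op1 op2 -> equiv op2 op3 -> equiv op1 op3.
Hypothesis iso_equiv : forall (T1 T2 : Type) (op1 : T1 -> T1 -> T1)
  (op2 : T2 -> T2 -> T2), loop_isomorphic op1 op2 -> equiv op1 op2.

Lemma card_nilpotent_classes (aT : finGroupType)
    (to : {action aT &-> normal_cocycle 'F_q}) (G : {group aT}) :
  (forall f g : normal_cocycle 'F_q, g \in orbit to G f <->
     equiv (central_ext (val f)) (central_ext (val g))) ->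
  #|equivalence_partition
      (fun s t : mul_table (2 * q) => `[< equiv (table_op s) (table_op t) >])
      (nilpotent_loops (2 * q))| = #|orbit to G @: setT|.
Proof.
move=> orbitE; have card_ext : #|{: bool * 'F_q}| = (2 * q)%N.
  by rewrite card_prod card_bool card_Fp.
have [h hP] := choice (fun f : normal_cocycle 'F_q =>
                         isomorphic_table (central_ext (val f)) card_ext).
have ext_equiv (f : normal_cocycle 'F_q) :
    equiv (central_ext (val f)) (table_op (h f)) by apply: iso_equiv.
apply: (@card_equivalence_partition_orbits _ _ _ _ _ _ _ h).
- move=> s t r _ _ _; split; first exact/asboolP/iso_equiv/loop_isomorphic_refl.
  move=> /asboolP st; apply/asboolP/asboolP; last exact: equiv_trans.
  exact/equiv_trans/equiv_sym.
- move=> f; rewrite inE; have [fr0 fl0 _] := (normal_cocycleP _).1 (valP f).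
  have fL := central_ext_loop fr0 fl0; apply/asboolP; split.
    exact: loop_isomorphic_is_loop (hP f) fL.
  exact: loop_isomorphic_nilpotent (hP f) fL (central_ext_nilpotent fr0 fl0).
- move=> t; rewrite inE => /asboolP[L nil_t].
  have [f fN f_iso] :=
    nilpotent_loop_central_ext q_pr q_odd (card_ord _) L nil_t.
  exists (exist _ f fN); apply/asboolP.
  exact: equiv_trans (equiv_sym (ext_equiv (exist _ f fN))) (iso_equiv f_iso).
- move=> f g; apply/asboolP/idP => [hfg|/orbitE fg].
    exact/orbitE/(equiv_trans (ext_equiv f))/(equiv_trans hfg)/equiv_sym.
  exact: equiv_trans (equiv_sym (ext_equiv f)) (equiv_trans fg (ext_equiv g)).
Qed.

End OrbitClasses.

Lemma num_nilpotent_isotopyE : num_nilpotent_isotopy (2 * q) =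
  #|orbit (class_action two_neq0) [set: dilation 'F_q] @: setT|.
Proof.
apply: (card_nilpotent_classes isotopic_sym isotopic_trans) => [T1 T2|].
  exact: loop_isomorphic_isotopic.
exact: mem_orbit_isotopic.
Qed.

Lemma num_nilpotent_isoE : num_nilpotent_iso (2 * q) =
  #|orbit (class_action two_neq0) (homotheties 'F_q) @: setT|.
Proof.
apply: (card_nilpotent_classes loop_isomorphic_sym loop_isomorphic_trans) => //.
exact: mem_orbit_isomorphic.
Qed.

End NilpotentClasses.

(** * Fixed points of dilations *)

Lemma bool_mulrn (b : bool) n : b *+ n = odd n && b.
Proof.
by elim: n => // n IHn; rewrite mulrS IHn /=; case: b {IHn}; case: (odd n).
Qed.

Lemma card_free_pairs (F : finFieldType) :
  #|free_pairs F| = ((#|F| - 1) * (#|F| - 2))%N.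
Proof.
pose nz : {set F} := [set~ 0].
have card_nz : #|nz| = (#|F| - 1)%N by rewrite cardsC1 subn1.
have -> : free_pairs F = setX nz nz :\: [set (x, x) | x in nz].
  apply/setP => -[x y]; rewrite !inE /= andbC.
  have -> : ((x, y) \in [set (z, z) | z in nz]) = (x != 0) && (x == y).
    apply/imsetP/andP => [[z]|[x0 /eqP <-]]; last by exists x; rewrite ?inE.
    by rewrite !inE => z0 [-> ->].
  by case: (x == 0); case: (y == 0); case: (x == y).
rewrite cardsD (setIidPr _); last first.
  by apply/subsetP => _ /imsetP[x x_nz ->]; rewrite inE /= x_nz.
rewrite cardsX card_imset => [|x y []//].
by rewrite card_nz -[X in (_ - X)%N]muln1 -mulnBr -subnDA.
Qed.

Section ClassFixedPoints.

Variable F : finFieldType.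
Hypothesis two_neq0 : 2 != 0 :> F.

Local Notation on_classes := (class_action two_neq0).
Local Notation on_cocycles := (ffun_action bool (dilation_action F)).

Lemma Fix_classP (f : normal_cocycle F) (d : dilation F) :
  reflect (normalize (cocycle_act (val f) d) = val f)
          (f \in 'Fix_on_classes[d]).
Proof. by apply: (iffP afix1P) => [{2}<-|fixed //]; last exact: val_inj. Qed.

Lemma card_Fix_non_translation (d : dilation F) : d.1 != 1%g ->
  #|'Fix_on_classes[d]| = #|'Fix_on_classes[homothety d.1]|.
Proof. by move=> /conj_homothety[e {1}->]; apply: card_Fix_conj. Qed.

Lemma Fix_cocycleB (d : dilation F) (f g : cocycle F) :
  f \in 'Fix_on_cocycles[d] -> g \in 'Fix_on_cocycles[d] ->
  f - g \in 'Fix_on_cocycles[d].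
Proof.
move=> /afix1P fd /afix1P gd; apply/afix1P; rewrite -[in RHS]fd -[in RHS]gd.
by apply/ffunP => z; rewrite !ffunE.
Qed.

Lemma homothety_acts_free_pairs (A : {set {unit F}}) :
  [acts (@homothety F @* A), on free_pairs F | dilation_action F].
Proof.
apply/subsetP => _ /morphimP[u _ _ ->]; rewrite !inE /=.
apply/subsetP => -[x y]; rewrite !inE /= !addr0 !mulf_eq0.
by rewrite (inj_eq (mulfI (unit_neq0 u))) (negbTE (unit_neq0 u)).
Qed.

Lemma homothety_semiregular (u : {unit F}) :
  {in free_pairs F, forall z, 'C_<[homothety u]>[z | dilation_action F] = 1%g}.
Proof.
move=> z; rewrite inE => /and3P[z1_neq0 _ _].
apply/trivgP/subsetP => _ /setIP[/cycleP[i ->] /astab1P].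
rewrite -morphX ?inE // => /(congr1 fst) /=.
rewrite addr0 -[RHS]mul1r => /(mulIf z1_neq0) ui1.
by apply/eqP; congr (_, _); apply: val_inj.
Qed.

Lemma Fix_homothety (u : {unit F}) :
  val @: 'Fix_on_classes[homothety u] =
  normal_cocycles F :&: 'Fix_on_cocycles(<[homothety u]>).
Proof.
apply/setP => f; rewrite afix_cycle; apply/imsetP/setIP => [[g gu ->]|[fN fu]].
  split; first exact: valP; apply/afix1P; rewrite -[RHS](Fix_classP g _ gu).
  by rewrite normalize_id // homothety_act_normal // (valP g).
exists (exist _ f fN) => //; apply/Fix_classP.
by rewrite /= -[cocycle_act _ _]/(on_cocycles f _) (afix1P fu) normalize_id.
Qed.

Lemma card_Fix_homothety (u : {unit F}) :
  #|'Fix_on_classes[homothety u]| =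
  (2 ^ ((#|F| - 2) * ((#|F| - 1) %/ #[u])))%N.
Proof.
have hu : @homothety F @* <[u]> = <[homothety u]> by rewrite morphim_cycle ?inE.
have acts_free := homothety_acts_free_pairs <[u]>; rewrite hu in acts_free.
rewrite -(card_imset _ val_inj) Fix_homothety card_Fix_ffun // card_bool.
have u_dvd : (#[u] %| #|F| - 1)%N.
  by rewrite subn1 -card_finField_unit order_dvdG ?inE.
have := card_semiregular acts_free (@homothety_semiregular u).
rewrite card_free_pairs -orderE order_injm ?injm_homothety ?inE // => orbits.
congr (2 ^ _)%N; apply/eqP; rewrite -(eqn_pmul2r (order_gt0 u)) -mulnA divnK //.
by rewrite -orbits mulnC.
Qed.

(* Summing f over the odd number of its translates by the powers of d gives a
   d-invariant function in the class of f. *)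
Lemma card_Fix_odd_order (d : dilation F) : odd #[d] ->
  #|'Fix_on_classes[d]| = #|@normalize F @: 'Fix_on_cocycles[d]|.
Proof.
move=> d_odd; rewrite -(card_imset _ val_inj); apply: eq_card => f.
apply/imsetP/imsetP => [[g gd ->]|[h /afix1P hd ->]]; last first.
  exists (normal_form two_neq0 h) => //; apply/Fix_classP => /=.
  rewrite -[in RHS]hd; apply: eq_normalize_cocycle_act => //.
  by rewrite normalize_id // normalize_normal.
exists (\sum_(a in <[d]>) on_cocycles (val g) a).
  rewrite -afix_cycle; apply/Fix_ffunP => z a da; rewrite !sum_ffunE.
  rewrite (reindex_inj (mulIg a)) /=.
  by apply: eq_big => b; rewrite ?groupMr // !ffunE invMg actM actK.
rewrite raddf_sum /= (eq_bigr (fun=> val g)) => [|a da]; last first.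
  by apply/Fix_classP/afix1P; move: gd; rewrite -afix_cycle => /afixP->.
rewrite sumr_const -orderE; apply/ffunP => z.
by rewrite ffunMnE bool_mulrn d_odd.
Qed.

End ClassFixedPoints.

Lemma normalize_const (F : finFieldType) (b : bool) :
  2 != 0 :> F -> normalize ([ffun=> b] : cocycle F) = 0.
Proof.
move=> two_neq0.
rewrite -(normalize_split two_neq0 (fun=> b) (fun=> 0) (fun=> 0)).
by congr normalize; apply/ffunP => z; rewrite !ffunE !addr0.
Qed.

Lemma translationX (F : finFieldType) (s t : F) n :
  (translation s t ^+ n)%g = translation (s *+ n) (t *+ n).
Proof.
elim: n => // n IHn; rewrite expgSr IHn; congr (_, (_, _)) => /=.
- by rewrite mulg1.
- by rewrite mul1r mulrSr.
- by rewrite mul1r mulrSr.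
Qed.

Lemma dilate_translation (F : finFieldType) (s t x y : F) :
  dilate (x, y) (translation s t) = (x + s, y + t).
Proof. by rewrite /dilate /= !mul1r. Qed.

Lemma sum_affine (R : nmodType) (F : finFieldType) (a : F -> R) (x s : F) :
  s != 0 -> \sum_i a (x + i * s) = \sum_i a i.
Proof.
by move=> s0; rewrite [RHS](reindex_inj (inj_comp (addrI x) (mulIf s0))).
Qed.

Section TranslationFixedPoints.

Variable q : nat.
Hypotheses (q_pr : prime q) (q_odd : odd q).

Let two_neq0 := Fp_two_neq0 q_pr q_odd.

Local Notation on_classes := (class_action two_neq0).
Local Notation on_cocycles := (ffun_action bool (dilation_action 'F_q)).

Lemma Fix_translation_inv (s t : 'F_q) (h : cocycle 'F_q) :
  h \in 'Fix_on_cocycles[translation s t] ->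
  forall i x y, h (x + i * s, y + i * t) = h (x, y).
Proof.
rewrite -afix_cycle => /Fix_ffunP hst i x y; rewrite -[i]natr_Zp !mulr_natl.
by rewrite -dilate_translation -translationX hst ?mem_cycle.
Qed.

Section NontrivialTranslation.

Variables s t : 'F_q.
Hypothesis st_neq0 : (s, t) != 0.

Lemma order_translation : #[translation s t] = q.
Proof.
apply: nt_prime_order => //.
by rewrite translationX !(mulrn_pchar (pchar_Fp q_pr)).
Qed.

Lemma translation_semiregular z :
  'C_<[translation s t]>[z | dilation_action 'F_q] = 1%g.
Proof.
case: z => x y; apply/trivgP/subsetP => _ /setIP[/cycleP[i ->] /astab1P].
rewrite translationX /= dilate_translation => -[xs yt]; rewrite inE.
apply/eqP; congr (_, (_, _)).
  by apply: (addrI x); rewrite xs addr0.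
by apply: (addrI y); rewrite yt addr0.
Qed.

Lemma Fix_degenerate_normalize0 (h : cocycle 'F_q) :
  [|| s == 0, t == 0 | s + t == 0] ->
  h \in 'Fix_on_cocycles[translation s t] -> normalize h = 0.
Proof.
move=> degenerate /Fix_translation_inv h_inv.
rewrite -(raddf0 (@normalize 'F_q)); apply/(normalize_eqP two_neq0).
case: (s =P 0) degenerate => [s0 _|/eqP s_neq0].
  have t_neq0 : t != 0 by apply: contraNneq st_neq0 => ->; rewrite s0.
  exists (fun x => h (x, 0)), (fun=> 0), (fun=> 0).
  apply/ffunP => -[x y]; rewrite !ffunE /= add0r !addr0.
  by rewrite -(h_inv (y / t) x 0) s0 mulr0 addr0 add0r divfK.
case: (t =P 0) => [t0 _|_ /= /eqP st0].
  exists (fun=> 0), (fun y => h (0, y)), (fun=> 0).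
  apply/ffunP => -[x y]; rewrite !ffunE /= !add0r addr0.
  by rewrite -(h_inv (x / s) 0 y) t0 mulr0 addr0 add0r divfK.
exists (fun=> 0), (fun=> 0), (fun x => h (x, 0)).
apply/ffunP => -[x y]; rewrite !ffunE /= !add0r -(h_inv (y / s) x y).
by rewrite -[t](addKr s) st0 addr0 mulrN divfK // subrr.
Qed.

Lemma card_Fix_degenerate_translation : [|| s == 0, t == 0 | s + t == 0] ->
  #|'Fix_on_classes[translation s t]| = 1%N.
Proof.
move=> degenerate; rewrite card_Fix_odd_order ?order_translation //.
rewrite -[RHS](cards1 (0 : cocycle 'F_q)); apply: eq_card => f; rewrite in_set1.
apply/imsetP/eqP => [[h hst ->]|->]; first exact: Fix_degenerate_normalize0.
exists 0; last by rewrite raddf0.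
by apply/afix1P/ffunP => z; rewrite !ffunE.
Qed.

Lemma card_orbits_setC_translation z :
  #|orbit (dilation_action 'F_q) <[translation s t]> @:
      (~: orbit (dilation_action 'F_q) <[translation s t]> z)| = (q - 1)%N.
Proof.
set to := dilation_action 'F_q; set G := <[translation s t]>.
have card_G : #|G| = q by rewrite -orderE order_translation.
have card_orbit_z : #|orbit to G z| = q.
  by rewrite -[RHS]card_G -(card_orbit_stab to _ z) translation_semiregular
    cards1 muln1.
have GactsC : [acts G, on ~: orbit to G z | to].
  by rewrite astabsC acts_orbit ?subsetT.
have := card_semiregular GactsC (fun z _ => translation_semiregular z).
rewrite cardsCs setCK card_orbit_z card_prod card_Fp // card_G.
rewrite -[X in (_ - X)%N]mul1n -mulnBl => /eqP.
by rewrite eqn_pmul2r ?prime_gt0 // => /eqP.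
Qed.

End NontrivialTranslation.

Section GenericTranslation.

Variables s t : 'F_q.
Hypotheses (s_neq0 : s != 0) (t_neq0 : t != 0) (st_sum_neq0 : s + t != 0).

(* Along each of the q translates of (x, y) by multiples of (s, t) the three
   terms of a split cocycle run over all their values. *)
Lemma Fix_generic_normalize0_const (h : cocycle 'F_q) :
  h \in 'Fix_on_cocycles[translation s t] -> normalize h = 0 ->
  forall z, h z = h 0.
Proof.
move=> /Fix_translation_inv h_inv; rewrite -(raddf0 (@normalize 'F_q)).
move=> /(normalize_eqP two_neq0)[a [b [c hE]]].
suff const z : h z = \sum_i a i + \sum_i b i + \sum_i c i.
  by move=> z; rewrite !const.
case: z => x y; transitivity (\sum_(i : 'F_q) h (x + i * s, y + i * t)).
  rewrite (eq_bigr (fun=> h (x, y))) => [|i _]; last exact: h_inv.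
  by rewrite sumr_const card_Fp // bool_mulrn q_odd.
rewrite -(sum_affine a x s_neq0) -(sum_affine b y t_neq0).
rewrite -(sum_affine c (x + y) st_sum_neq0) -!big_split; apply: eq_bigr => i _.
by rewrite hE !ffunE /= add0r mulrDr; congr (_ + c _); ring.
Qed.

Lemma card_Fix_generic_translation :
  #|'Fix_on_classes[translation s t]| = (2 ^ (q - 1))%N.
Proof.
have st_neq0 : (s, t) != 0 by apply: contraNneq s_neq0 => -[->].
rewrite card_Fix_odd_order ?order_translation //.
pose Fix0 := [set h in pffun_on false (~: orbit (dilation_action 'F_q)
                 <[translation s t]> 0) predT]
             :&: 'Fix_on_cocycles(<[translation s t]>).
have Fix0P h : reflect (h \in 'Fix_on_cocycles[translation s t] /\ h 0 = 0)
                       (h \in Fix0).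
  by rewrite -afix_cycle; apply: Fix_ffun_vanishingP.
have -> : @normalize 'F_q @: 'Fix_on_cocycles[translation s t] =
    @normalize 'F_q @: Fix0.
  apply/setP => f; apply/imsetP/imsetP => [[h hst ->]|]; last first.
    by case=> h /Fix0P[hst _] ->; exists h.
  exists (h - [ffun=> h 0]); last by rewrite raddfB /= normalize_const ?subr0.
  apply/Fix0P; rewrite !ffunE subrr; split=> //.
  by apply: Fix_cocycleB => //; apply/afix1P/ffunP => z; rewrite !ffunE.
rewrite card_in_imset; last first.
  move=> h h' /Fix0P[hst h0] /Fix0P[h'st h'0] normalize_hh'.
  have normalizeB : normalize (h - h') = 0.
    by rewrite raddfB /= normalize_hh' subrr.
  apply/subr0_eq/ffunP => z.
  rewrite (Fix_generic_normalize0_const (Fix_cocycleB hst h'st)) //.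
  by rewrite !ffunE h0 h'0.
rewrite card_Fix_ffun ?card_bool ?card_orbits_setC_translation //.
by rewrite astabsC acts_orbit ?subsetT.
Qed.

End GenericTranslation.

End TranslationFixedPoints.

(** * Counting orbits *)

Section Counting.

Variable q : nat.
Hypotheses (q_pr : prime q) (q_odd : odd q).

Let two_neq0 := Fp_two_neq0 q_pr q_odd.

Local Notation on_classes := (class_action two_neq0).

Lemma card_Fp_unit : #|[set: {unit 'F_q}]| = (q - 1)%N.
Proof. by rewrite card_finField_unit card_Fp // subn1. Qed.

Lemma card_Fix_homothetyX (g : {unit 'F_q}) e : #[g] = (q - 1)%N ->
  (e %| q - 1)%N ->
  #|'Fix_on_classes[(homothety g ^+ e)%g]| = (2 ^ ((q - 2) * e))%N.
Proof.
move=> order_g e_dvd; rewrite -morphX ?inE // card_Fix_homothety.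
rewrite orderXdiv order_g // card_Fp // divnA // mulKn //.
by rewrite subn_gt0 prime_gt1.
Qed.

Lemma num_nilpotent_iso_divisor_sum :
  (num_nilpotent_iso (2 * q))%:R =
  \sum_(1 <= d < (q - 1).+1 | (d %| q - 1)%N)
    d%:R^-1 * Pred_moebius (fun e => 2 ^+ ((q - 2) * e)) d :> rat.
Proof.
have /cyclicP[g gE] := field_unit_group_cyclic [set: {unit 'F_q}]%G.
have order_g : #[g] = (q - 1)%N by rewrite orderE -gE card_Fp_unit.
have order_hg : #[homothety g] = (q - 1)%N.
  by rewrite order_injm ?injm_homothety ?inE.
have homothetiesE : homotheties 'F_q = <[homothety g]>.
  by rewrite -morphim_cycle ?inE // -gE.
rewrite (num_nilpotent_isoE q_pr q_odd) homothetiesE natr_card_orbits_cycle.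
  rewrite order_hg big_nat_cond [RHS]big_nat_cond.
  apply: eq_bigr => d /andP[_ d_dvd]; congr (_ * (_ + _)).
    by rewrite setTI card_Fix_homothetyX // natrX.
  apply: eq_bigr => D /andP[D0 DPred].
  rewrite setTI card_Fix_homothetyX ?natrX //.
  exact: dvdn_trans (gcd_set_dvd D0 DPred) d_dvd.
by apply/actsP => ? _ ?; rewrite !inE.
Qed.

Lemma sum_Fix_homotheties :
  (\sum_(u : {unit 'F_q}) #|'Fix_on_classes[homothety u]| =
   num_nilpotent_iso (2 * q) * (q - 1))%N.
Proof.
rewrite (num_nilpotent_isoE q_pr q_odd) -card_Fp_unit.
rewrite -(card_injm (injm_homothety 'F_q) (subxx _)) -Frobenius_Cauchy;
  last by apply/actsP => ? _ ?; rewrite !inE.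
rewrite (eq_bigl (mem (@homothety 'F_q @: [set: {unit 'F_q}]))); last first.
  by move=> d; rewrite -morphimEdom.
rewrite big_imset /=; last by move=> u v _ _ [].
by apply: eq_big => u; rewrite ?inE // setTI.
Qed.

Lemma card_Fix_homothety1 :
  #|'Fix_on_classes[homothety 1%g]| = (2 ^ ((q - 2) * (q - 1)))%N.
Proof. by rewrite card_Fix_homothety order1 divn1 card_Fp. Qed.

Lemma sum_Fix_translations_row (s : 'F_q) : s != 0 ->
  (\sum_t #|'Fix_on_classes[translation s t]| = 2 + (q - 2) * 2 ^ (q - 1))%N.
Proof.
move=> s_neq0.
have st_neq0 (t : 'F_q) : (s, t) != 0 by apply: contraNneq s_neq0 => -[->].
rewrite (bigD1 0) //= (bigD1 (- s)) ?oppr_eq0 //=.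
rewrite !card_Fix_degenerate_translation ?eqxx ?orbT ?subrr ?eqxx ?orbT //.
rewrite addnA; congr (_ + _)%N.
rewrite (eq_bigr (fun=> (2 ^ (q - 1))%N)); last first.
  move=> t /andP[t_neq0 t_neqNs].
  by apply: card_Fix_generic_translation => //; rewrite addrC addr_eq0.
rewrite sum_nat_cond_const; congr (_ * _)%N.
have -> : [set t | (t != 0) && (t != - s)] = [set~ 0] :\ (- s).
  by apply/setP => t; rewrite !inE andbC.
have := cardsD1 (- s) [set~ 0].
by rewrite cardsC1 card_Fp // in_setC1 oppr_eq0 s_neq0 subn2 => ->.
Qed.

Lemma sum_Fix_translations :
  (\sum_(z : 'F_q * 'F_q) #|'Fix_on_classes[translation z.1 z.2]| =
   2 ^ ((q - 2) * (q - 1)) + 3 * (q - 1) + (q - 1) * (q - 2) * 2 ^ (q - 1))%N.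
Proof.
have card_nz : #|[set s : 'F_q | s != 0]| = (q - 1)%N.
  have -> : [set s : 'F_q | s != 0] = [set~ 0] by apply/setP => s; rewrite !inE.
  by rewrite cardsC1 card_Fp // subn1.
rewrite -(pair_bigA _ (fun s t => #|'Fix_on_classes[translation s t]|)) /=.
rewrite (bigD1 0) //= (eq_bigr _ sum_Fix_translations_row).
rewrite sum_nat_cond_const card_nz.
rewrite (bigD1 0) //= card_Fix_homothety1 (eq_bigr (fun=> 1%N)) => [|t t_neq0].
  by rewrite sum_nat_cond_const card_nz; lia.
by apply: card_Fix_degenerate_translation; rewrite ?eqxx.
Qed.

Lemma num_nilpotent_isotopy_iso :
  (num_nilpotent_isotopy (2 * q) * ((q - 1) * q ^ 2)
     + q ^ 2 * 2 ^ ((q - 2) * (q - 1)) =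
   q ^ 2 * (num_nilpotent_iso (2 * q) * (q - 1))
     + (2 ^ ((q - 2) * (q - 1)) + 3 * (q - 1)
        + (q - 1) * (q - 2) * 2 ^ (q - 1)))%N.
Proof.
pose fixed u z := #|'Fix_on_classes[((u, z) : dilation 'F_q)]|.
have card_dilation : #|[set: dilation 'F_q]| = ((q - 1) * q ^ 2)%N.
  by rewrite cardsT !card_prod -cardsT card_Fp_unit card_Fp.
have -> : (num_nilpotent_isotopy (2 * q) * ((q - 1) * q ^ 2) =
    \sum_(u : {unit 'F_q}) \sum_z fixed u z)%N.
  rewrite (num_nilpotent_isotopyE q_pr q_odd) -card_dilation -Frobenius_Cauchy.
    by rewrite pair_bigA; apply: eq_big => [d|[u z] _]; rewrite ?inE ?setTI.
  by apply/actsP => ? _ ?; rewrite !inE.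
rewrite -sum_Fix_homotheties -sum_Fix_translations (bigD1 1%g) //=.
rewrite [in RHS](bigD1 1%g) //= card_Fix_homothety1 mulnDr.
rewrite (eq_bigr (fun u => q ^ 2 * #|'Fix_on_classes[homothety u]|)%N).
  rewrite -big_distrr /=; set rest := (_ * \sum_(u | _) _)%N.
  rewrite -addnA [RHS]addnC (addnC rest); congr (_ + _)%N.
  by apply: eq_bigr => -[s t] _.
move=> u u_neq1; rewrite (eq_bigr (fun=> #|'Fix_on_classes[homothety u]|)).
  by rewrite sum_nat_const card_prod card_Fp.
by move=> z _; apply: card_Fix_non_translation.
Qed.

End Counting.

Lemma natr_num_nilpotent_isotopy q : prime q -> odd q ->
  (num_nilpotent_isotopy (2 * q))%:R =
  (num_nilpotent_iso (2 * q))%:R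
  + (q%:R ^+ 2)^-1 * (- (q%:R + 1) * 2 ^+ ((q - 2) * (q - 1))
                      + (q%:R - 2) * 2 ^+ (q - 1) + 3) :> rat.
Proof.
move=> q_pr q_odd; have q_gt1 := prime_gt1 q_pr.
have q_neq0 : q%:R != 0 :> rat by rewrite pnatr_eq0 -lt0n prime_gt0.
have q1_neq0 : q%:R - 1 != 0 :> rat by rewrite subr_eq0 pnatr_eq1 gtn_eqF.
have := congr1 (fun n => n%:R : rat) (num_nilpotent_isotopy_iso q_pr q_odd).
rewrite /= !(natrD, natrM, natrX) !natrB ?(ltnW q_gt1) // => burnside.
have card_neq0 : (q%:R - 1) * q%:R ^+ 2 != 0 :> rat.
  by rewrite mulf_neq0 ?expf_neq0.
apply: (mulIf card_neq0).
apply: (addIr (q%:R ^+ 2 * 2 ^+ ((q - 2) * (q - 1)))).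
by rewrite burnside; field.
Qed.

Theorem theorem6p10 (q : nat) (q_prime : prime q) (q_odd : odd q) :
  ((num_nilpotent_isotopy (2 * q)%N)%:R : rat) =
      2 ^+ ((q - 2) * (q - 1)) / (q%:R ^+ 2 * (q%:R - 1))
    + (q%:R - 1)^-1 *
        (\sum_(D : {set 'I_(q - 1)} | (D != set0) && (D \subset Pred (q - 1)))
           (-1) ^+ #|D| * 2 ^+ ((q - 2) * gcd_set D))
    + \sum_(1 <= d < q - 1 | (d %| q - 1)%N)
        d%:R^-1 *
        (2 ^+ ((q - 2) * d)
         + \sum_(D : {set 'I_d} | (D != set0) && (D \subset Pred d))
             (-1) ^+ #|D| * 2 ^+ ((q - 2) * gcd_set D))
    + (q%:R ^+ 2)^-1 * ((q%:R - 2) * 2 ^+ (q - 1) + 3)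
  /\
  ((num_nilpotent_isotopy (2 * q)%N)%:R : rat) =
      (num_nilpotent_iso (2 * q)%N)%:R
    + (q%:R ^+ 2)^-1 *
        (- (q%:R + 1) * 2 ^+ ((q - 2) * (q - 1))
         + (q%:R - 2) * 2 ^+ (q - 1) + 3).
Proof.
have q_gt1 := prime_gt1 q_prime.
have q1E : (q - 1)%:R = q%:R - 1 :> rat by rewrite natrB // ltnW.
have q_neq0 : q%:R != 0 :> rat by rewrite pnatr_eq0 -lt0n ltnW.
have q1_neq0 : q%:R - 1 != 0 :> rat by rewrite subr_eq0 pnatr_eq1 gtn_eqF.
have isotopyE := natr_num_nilpotent_isotopy q_prime q_odd.
split=> //; rewrite isotopyE num_nilpotent_iso_divisor_sum //.
rewrite big_mkcond big_nat_recr ?subn_gt0 //= dvdnn -big_mkcond /= q1E.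
by rewrite /Pred_moebius; field; rewrite q_neq0 q1_neq0.
Qed.
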